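(* Let $\Delta<\infty$ and $k\ge 1$ be integers. There exist increasing homeomorphisms $\rho,\sigma:[0,1]\to[0,1]$, depending only on $\Delta$ and $k$, such that for every graph $G=(V,E)$ with maximum degree $\Delta$ and every positively associated, $k$-independent bond percolation model $\mathrm{P}$ on $G$ with marginals $p$, $$\pi_{\rho(p)}\preceq \mathrm{P}\preceq \pi_{\sigma(p)},$$ where $\pi_q$ denotes the Bernoulli bond percolation model on $\{0,1\}^E$ with marginals $q$ and $\preceq$ denotes stochastic domination.
   Context: For an undirected graph $G=(V,E)$, a bond percolation model is a probability measure $\mathrm{P}$ on $\{0,1\}^E$ with the product $\sigma$-algebra. $d(u,v)$ is the graph distance; for edges, $d(e,f)=\inf\{d(u,v): u\in e, v\in f\}$, and for edge sets, $d(F_1,F_2)=\inf\{d(e,f): e\in F_1,f\in F_2\}$. An event $A$ is increasing if $\omega\in A$ and $\omega\le\omega'$ (coordinatewise) imply $\omega'\in A$. $\mathrm{P}$ is positively associated if $\mathrm{P}[A_1\cap A_2]\ge \mathrm{P}[A_1]\,\mathrm{P}[A_2]$ for all increasing events $A_1,A_2$. $\mathrm{P}$ is $k$-independent if the edge statuses in $F_1$ are independent of the edge statuses in $F_2$ whenever $F_1,F_2\subseteq E$ are disjoint and at distance at least $k$. $\mathrm{P}$ has marginals $p\in[0,1]$ if $\mathrm{P}[\omega(e)=1]=p$ for all $e\in E$. $\pi_q$ is the law under which all edges are open independently with probability $q$. Stochastic domination: $\mu\preceq\nu$ if $\mathbb{E}_\mu[f]\le\mathbb{E}_\nu[f]$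 for every bounded measurable increasing function $f:\{0,1\}^E\to\mathbb{R}$. *)

(* Defs.v *)
From HB Require Import structures.
From mathcomp Require Import all_boot all_order all_algebra.
From mathcomp Require Import finmap.
From mathcomp Require Import all_classical all_reals all_analysis.

Set Implicit Arguments.
Unset Strict Implicit.
Unset Printing Implicit Defensive.

Import Order.TTheory GRing.Theory Num.Theory.
Import numFieldNormedType.Exports.

Local Open Scope classical_set_scope.
Local Open Scope ring_scope.

Record graph := Graph {
  vertex :> choiceType;
  adj : rel vertex;
  adj_sym : symmetric adj;
  adj_irrefl : irreflexive adj }.

Definition edges (G : graph) : set (set G) :=
  [set e | exists u v : G, adj u v /\ e = [set u; v]].

Arguments edges : clear implicits.

Definition edge (G : graph) : choiceType := set_type (edges G).

Definition neighbours (G : graph) (v : G) : set G := [set u | adj v u].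

Definition has_max_degree (G : graph) (Delta : nat) : Prop :=
  (forall v : G, neighbours v #<= `I_Delta)%card /\
  (exists v : G, neighbours v #= `I_Delta)%card.

(* Distances take values in the extended reals, so that the infimum over the
   empty set (vertices in different components, empty edge sets) is +oo. *)
Section distances.
Context (R : realType) (G : graph).

Definition dist (u v : G) : \bar R :=
  ereal_inf [set (size s)%:R%:E | s in [set s : seq G | path (@adj G) u s /\
                                                        last u s = v]].

Definition edge_dist (e f : edge G) : \bar R :=
  ereal_inf [set dist uv.1 uv.2 | uv in val e `*` val f].

Definition edge_set_dist (F1 F2 : set (edge G)) : \bar R :=
  ereal_inf [set edge_dist ef.1 ef.2 | ef in F1 `*` F2].

End distances.

Definition open_event (I : Type) (i : I) : set (I -> bool) := [set w | w i].

(* The events depending only on the coordinates in F are <<s open_events F >>. *)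
Definition open_events (I : Type) (F : set I) : set (set (I -> bool)) :=
  [set open_event i | i in F].

(* {0,1}^I with the product sigma-algebra *)
Definition config (I : choiceType) :=
  g_sigma_algebraType (@open_events I [set: I]).

Definition config_le (I : choiceType) (w w' : config I) : Prop :=
  forall i, (w i <= w' i)%O.

Definition percolation (R : realType) (I : choiceType) :=
  probability (config I) R.

Section percolation_notions.
Context (R : realType) (I : choiceType).
Implicit Types P Q : percolation R I.

Definition increasing_event (A : set (config I)) : Prop :=
  measurable A /\ forall w w', A w -> config_le w w' -> A w'.

Definition positively_associated P : Prop :=
  forall A1 A2, increasing_event A1 -> increasing_event A2 ->
  (P A1 * P A2 <= P (A1 `&` A2))%E.

Definition has_marginals P (p : R) : Prop :=
  forall i, P (open_event i) = p%:E.

Definition increasing_function (f : config I -> R) : Prop :=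
  forall w w', config_le w w' -> f w <= f w'.

Definition stoch_dominated P Q : Prop :=
  forall f : config I -> R, measurable_fun [set: config I] f ->
    bounded_fun f -> increasing_function f -> ('E_P[f] <= 'E_Q[f])%E.

Definition independent_coordinates P : Prop :=
  forall (s : seq I) (b : I -> bool), uniq s ->
  P [set w | forall i, i \in s -> w i = b i] =
  (\prod_(i <- s) P [set w | w i = b i])%E.

Definition bernoulli_law (q : R) P : Prop :=
  has_marginals P q /\ independent_coordinates P.

End percolation_notions.

Definition k_independent (R : realType) (G : graph) (k : nat)
    (P : percolation R (edge G)) : Prop :=
  forall F1 F2 : set (edge G), F1 `&` F2 = set0 ->
    (k%:R%:E <= edge_set_dist R F1 F2)%E ->
  forall A1 A2 : set (config (edge G)),
    <<s open_events F1 >> A1 -> <<s open_events F2 >> A2 ->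
  P (A1 `&` A2) = (P A1 * P A2)%E.

(* Self-maps of the unit interval are represented by functions on R, of which
   only the values on [0, 1] are constrained. *)
Definition increasing_homeomorphism (R : realType) (f : R -> R) : Prop :=
  {in `[0, 1] &, {homo f : x y / x < y}} /\
  exists g : R -> R,
    [/\ {homo f : x / x \in `[0, 1]}, {homo g : x / x \in `[0, 1]},
        {in `[0, 1], cancel f g}, {in `[0, 1], cancel g f} &
        {within `[0, 1], continuous f} /\ {within `[0, 1], continuous g}].

(* Existence of the Bernoulli law: the product weights define a content on the
   algebra of cylinder sets, which is sigma-subadditive by compactness. *)
Section bernoulli_content.
Context (R : realType) (I : choiceType) (q : R).
Local Notation C := (I -> bool).

Definition upd (w : C) (i : I) (b : bool) : C :=
  fun j => if j == i then b else w j.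

Definition avg (i : I) (f : C -> R) : C -> R :=
  fun w => q * f (upd w i true) + (1 - q) * f (upd w i false).

Definition avgs (s : seq I) (f : C -> R) : C -> R := foldr avg f s.

Definition determined (T : Type) (s : seq I) (f : C -> T) : Prop :=
  forall w w' : C, {in s, w =1 w'} -> f w = f w'.

Lemma avg_comm i j f : avg i (avg j f) = avg j (avg i f).
Proof.
have [->//|ij] := eqVneq i j.
have updC w a b : upd (upd w i a) j b = upd (upd w j b) i a.
  apply/funext => x; rewrite /upd; case: (eqVneq x j) => // ->.
  by rewrite eq_sym (negbTE ij).
apply/funext => w; rewrite /avg !updC !mulrDr !mulrA.
by rewrite -!addrA; congr (_ + _); rewrite addrCA ![(1 - q) * q]mulrC.
Qed.

Lemma avg_avgs i s f : avg i (avgs s f) = avgs s (avg i f).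
Proof. by elim: s => //= j s IH; rewrite avg_comm IH. Qed.

Lemma avgs_comm s t f : avgs s (avgs t f) = avgs t (avgs s f).
Proof. by elim: s => //= i s IH; rewrite IH avg_avgs. Qed.

Lemma avg_cst i c : avg i (fun=> c) = fun=> c.
Proof. by apply/funext => w; rewrite /avg -mulrDl addrC subrK mul1r. Qed.

Lemma avgs_cst s c : avgs s (fun=> c) = fun=> c.
Proof. by elim: s => //= i s ->; rewrite avg_cst. Qed.

Lemma avgsD s f g : avgs s (fun w => f w + g w) = fun w => avgs s f w + avgs s g w.
Proof.
elim: s => //= i s ->; apply/funext => w.
by rewrite /avg !mulrDr addrACA.
Qed.

Lemma avgsZ s c f : avgs s (fun w => c * f w) = fun w => c * avgs s f w.
Proof.
elim: s => //= i s ->; apply/funext => w.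
by rewrite /avg mulrDr !mulrA [c * q]mulrC [c * (1 - q)]mulrC.
Qed.

Lemma avgs_determined s f : determined s f -> determined [::] (avgs s f).
Proof.
elim: s f => //= i s IH f df; rewrite avg_avgs; apply: IH => w w' ww'.
by rewrite /avg; congr (_ * _ + _ * _); apply: df => j;
  rewrite inE /upd; case: eqP => //= _; exact: ww'.
Qed.

Definition w0 : C := fun=> false.

Lemma avgs_const s f : determined s f -> avgs s f = fun=> avgs s f w0.
Proof. by move=> df; apply/funext => w; exact: (avgs_determined df). Qed.

Lemma avgs_indep s t f : determined s f -> determined t f ->
  avgs s f w0 = avgs t f w0.
Proof.
move=> ds dt; have := avgs_comm s t f.
rewrite (avgs_const ds) (avgs_const dt) !avgs_cst.
by move=> /(congr1 (fun h => h w0)).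
Qed.

Hypothesis q01 : 0 <= q <= 1.

Lemma avgs_le s f g : (forall w, f w <= g w) -> forall w, avgs s f w <= avgs s g w.
Proof.
move=> fg; elim: s => //= i s IH w; rewrite /avg.
by case/andP: q01 => q0 q1; apply: lerD; apply: ler_wpM2l => //; rewrite subr_ge0.
Qed.

Definition cylinder (A : set C) : Prop := exists s, determined s A.

Lemma cylinder0 : cylinder set0.
Proof. by exists [::]. Qed.

Lemma determinedW T (s t : seq I) (f : C -> T) :
  {subset s <= t} -> determined s f -> determined t f.
Proof. by move=> st df w w' ww'; apply: df => i /st; exact: ww'. Qed.

Lemma determinedU s t (A B : set C) : determined s A -> determined t B ->
  determined (s ++ t) (A `|` B).
Proof.
move=> dA dB w w' ww'; rewrite /setU /mkset.
by congr (_ \/ _); [apply: dA|apply: dB] => i it; apply: ww';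
  rewrite mem_cat it ?orbT.
Qed.

Lemma cylinderU : setU_closed cylinder.
Proof.
by move=> A B [s ds] [t dt]; exists (s ++ t); exact: determinedU.
Qed.

Lemma cylinderC : setC_closed cylinder.
Proof.
by move=> A [s ds]; exists s => w w' ww'; rewrite /setC /mkset (ds _ _ ww').
Qed.

End bernoulli_content.

Definition cyl_type (I : choiceType) := I -> bool.
HB.instance Definition _ (I : choiceType) := Pointed.on (cyl_type I).

Fact cyl_display : measure_display. Proof. exact. Qed.

HB.instance Definition _ (I : choiceType) :=
  @isAlgebraOfSets.Build cyl_display (cyl_type I) (@cylinder I)
    (@cylinder0 I) (@cylinderU I) (@cylinderC I).

Definition cube (I : choiceType) := prod_topology (fun _ : I => bool).
HB.instance Definition _ (I : choiceType) := Topological.on (cube I).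
HB.instance Definition _ (I : choiceType) :=
  isPointed.Build (cube I) (fun=> false).

Lemma cylinder_open (I : choiceType) (A : set (cube I)) :
  @cylinder I A -> open A.
Proof.
move=> [s ds]; rewrite openE => w Aw; rewrite /interior.
suff : \forall w' \near w, {in s, w' =1 w}.
  by apply: filterS => w' ww'; rewrite (ds _ _ ww').
elim: s {ds} => [|i s IH]; first by near=> w' => j; rewrite in_nil.
have Hi : \forall w' \near w, (w' : I -> bool) i = w i.
  have /(_ [set w i]) := @proj_continuous I (fun=> bool) i w.
  by apply; apply: open_nbhs_nbhs; split => //; exact: discrete_open.
near=> w' => j; rewrite inE => /predU1P[->|js]; first by near: w'; exact: Hi.
by move: j js; near: w'; exact: IH.
Unshelve. all: by end_near. Qed.

Section bernoulli_measure.
Context (R : realType) (I : choiceType) (q : R).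
Hypothesis q01 : 0 <= q <= 1.
Local Notation T := (cyl_type I).

Let avgs := @avgs R I q.
Let w0 := @w0 I.

Definition cyl_support (A : set T) : seq I :=
  xget [::] [set s | determined s A].

Definition cyl_content (A : set T) : \bar R :=
  (avgs (cyl_support A) \1_A w0)%:E.

Lemma determined_indic (s : seq I) (A : set T) :
  determined s A -> determined s (\1_A : T -> R).
Proof.
move=> ds w w' ww'; rewrite !indicE; congr (_%:R); congr (nat_of_bool _).
by apply: asbool_equiv_eq; rewrite (ds _ _ ww').
Qed.

Lemma cyl_contentE (s : seq I) (A : set T) : determined s A ->
  cyl_content A = (avgs s \1_A w0)%:E.
Proof.
move=> ds; congr EFin; apply: avgs_indep; apply: determined_indic => //.
exact: (@xgetPex _ [::] [set s | determined s A] (ex_intro _ s ds)).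
Qed.

Lemma cyl_content_ge0 A : (0 <= cyl_content A)%E.
Proof.
rewrite lee_fin -[leLHS](_ : avgs (cyl_support A) (fun=> 0) w0 = 0).
  by apply: avgs_le => // w; rewrite indicE.
by rewrite /avgs avgs_cst.
Qed.

Lemma cyl_content0 : cyl_content set0 = 0%E.
Proof.
rewrite (@cyl_contentE [::])//= indicE.
by rewrite in_set0.
Qed.

Lemma cyl_content_additive : measure_function.semi_additive cyl_content.
Proof.
apply/additive2P; first exact: cyl_content0.
move=> A B [s ds] [t dt] AB0.
rewrite (cyl_contentE (determinedU ds dt)).
have dA : determined (s ++ t) A.
  by apply: determinedW ds => i; rewrite mem_cat => ->.
have dB : determined (s ++ t) B.
  by apply: determinedW dt => i; rewrite mem_cat orbC => ->.
rewrite (cyl_contentE dA) (cyl_contentE dB) -EFinD; congr EFin.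
rewrite (_ : \1_(A `|` B) = fun w => \1_A w + \1_B w).
  by rewrite /avgs avgsD.
apply/funext => w; rewrite !indicE in_setU.
case: (boolP (w \in A)) => /= wA; last by rewrite add0r.
case: (boolP (w \in B)) => /= wB; last by rewrite addr0.
have : (A `&` B) w by split; exact: set_mem.
by rewrite AB0.
Qed.

HB.instance Definition _ := isContent.Build _ _ R cyl_content
  cyl_content_ge0 cyl_content_additive.

Lemma cyl_content_sigma_subadditive :
  measurable_subset_sigma_subadditive cyl_content.
Proof.
move=> A F mF mA AF.
pose K := cube I.
have cT : compact [set: K].
  rewrite (_ : setT = [set f : K | forall i, [set: bool] (f i)]).
    by have := @tychonoff I (fun=> bool) (fun=> setT) (fun=> bool_compact).
  by apply/seteqP; split.
move: cT; rewrite compact_cover => /(_ nat setT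
  (fun n => (~` A `|` F n) : set K)).
case.
- move=> n _; apply: cylinder_open; apply: cylinderU.
    exact: cylinderC mA.
  exact: (mF n).
- move=> w _; have [Aw|nAw] := pselect (A w).
    by have [n _ Fnw] := AF _ Aw; exists n => //; right.
  by exists 0%N => //; left.
move=> D _ cD.
have H : (cyl_content A <= \sum_(i <- D) cyl_content (F i))%E.
  have h : A `<=` \bigcup_(i in [set` D]) F i.
    by move=> w Aw; have [n Dn [//|Fn]] := cD w Logic.I; exists n.
  have := content_sub_fsum (cyl_content : {content set T -> \bar R})
    (finite_fset D) (fun k _ => mF k) mA h.
  by rewrite fsbig_finite//= set_fsetK.
apply: (le_trans H).
rewrite nneseries_esum//.
apply: esum_ge; exists [set` D]; last by rewrite fsbig_finite//= set_fsetK.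
by split; first exact: finite_fset.
Qed.

HB.instance Definition _ := Content_SigmaSubAdditive_isMeasure.Build _ _ _
  cyl_content cyl_content_sigma_subadditive.

Local Notation ext := (measure_extension cyl_content).

Lemma measurable_cyl (A : set (config I)) : measurable A ->
  <<s @cylinder I >> A.
Proof.
apply: smallest_sub; first exact: smallest_sigma_algebra.
move=> _ [i _ <-]; apply: sub_gen_smallest.
by exists [:: i] => w w' ww'; rewrite /open_event /mkset ww'// inE.
Qed.

Definition product_measure (A : set (config I)) : \bar R := ext A.

Lemma product_measure0 : product_measure set0 = 0%E.
Proof. exact: measure0. Qed.

Lemma product_measure_ge0 A : (0 <= product_measure A)%E.
Proof. exact: measure_ge0. Qed.

Lemma product_measure_sigma : semi_sigma_additive product_measure.
Proof.
move=> F mF tF mUF.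
apply: (@measure_semi_sigma_additive _ _ _ ext) => //.
- by move=> n; exact: measurable_cyl.
- exact: measurable_cyl.
Qed.

HB.instance Definition _ := isMeasure.Build _ _ _ product_measure
  product_measure0 product_measure_ge0 product_measure_sigma.

Lemma product_measureE (s : seq I) (A : set T) : determined s A ->
  product_measure A = (avgs s \1_A w0)%:E.
Proof.
move=> ds; rewrite /product_measure /measure_extension measurable_mu_extE/=.
  exact: cyl_contentE.
by exists s.
Qed.

Lemma product_measureT : product_measure setT = 1%E.
Proof. by rewrite (@product_measureE [::])//= indicT. Qed.

HB.instance Definition _ :=
  Measure_isProbability.Build _ _ _ product_measure product_measureT.

Lemma product_measure_cylinder (s : seq I) (b : I -> bool) : uniq s ->
  product_measure [set w | forall i, i \in s -> w i = b i] =
  (\prod_(i <- s) if b i then q else 1 - q)%:E.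
Proof.
move=> us; rewrite (@product_measureE s); last first.
  move=> w w' ww'; rewrite /mkset; apply/propext; split => h i si.
    by rewrite -ww'// h.
  by rewrite ww'// h.
congr EFin; elim: s us => [|i s IH] /=.
  by rewrite big_nil indicE mem_set.
move=> /andP[si us]; rewrite big_cons -IH// /avgs avg_avgs.
set A := [set w | _]; set B := [set w : T | _].
have -> : avg q i \1_A = fun w => (if b i then q else 1 - q) * \1_B w.
  apply/funext => w; rewrite /avg.
  have E c : (\1_A (upd w i c) : R) = (c == b i)%:R * \1_B w.
    rewrite !indicE -natrM mulnb; congr (_%:R); congr (nat_of_bool _).
    apply/idP/idP.
      move=> /set_mem hA; apply/andP; split.
        by have := hA i; rewrite inE eqxx /upd eqxx => ->.
      apply/mem_set => j js; have := hA j; rewrite inE js orbT /upd.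
      by case: eqP => [ji|_ ->//]; move: si; rewrite -ji js.
    move=> /andP[/eqP cb /set_mem hB]; apply/mem_set => j.
    by rewrite inE /upd; case: eqP => [->//|_ /= js]; exact: hB.
  rewrite !E; case: (b i) => /=.
    by rewrite mul1r mul0r mulr0 addr0.
  by rewrite mul1r mul0r mulr0 add0r.
by rewrite avgsZ.
Qed.

Lemma product_measure_bernoulli : bernoulli_law q product_measure.
Proof.
have one i c : product_measure [set w | w i = c] =
    (if c then q else 1 - q)%:E.
  have := @product_measure_cylinder [:: i] (fun=> c) isT.
  rewrite big_seq1 => <-; congr product_measure.
  apply/funext => w; apply/propext; split=> [wi j|].
    by rewrite inE => /eqP ->.
  by apply; rewrite inE.
split=> [i|s b us].
  rewrite -[RHS](one i true); congr product_measure.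
apply: (etrans (product_measure_cylinder b us)).
by rewrite -prodEFin; apply: eq_bigr => i _; rewrite -(one i).
Qed.

End bernoulli_measure.

Lemma bernoulli_law_exists (R : realType) (I : choiceType) (q : R) :
  exists P : percolation R I, 0 <= q <= 1 -> bernoulli_law q P.
Proof.
case: (boolP (0 <= q <= 1)) => [q01|_].
  by exists (product_measure q01) => _; exact: product_measure_bernoulli.
by exists (\d_(point : config I)).
Qed.

(* The Bernoulli percolation pi_q; unspecified when q is not in [0, 1]. *)
Definition bernoulli_percolation (R : realType) (I : choiceType) (q : R) :
  percolation R I := sval (cid (bernoulli_law_exists I q)).

Lemma bernoulli_percolationP (R : realType) (I : choiceType) (q : R) :
  0 <= q <= 1 -> bernoulli_law q (bernoulli_percolation I q).
Proof. exact: (svalP (cid (bernoulli_law_exists I q))). Qed.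

(* Main.v *)
(* Both bounds reduce to finitely many edges and to one law [m] on subsets: if
   [nu] is dominated by [m] and satisfies [q * nu S <= (1 - q) * nu (e |: S)]
   for all [e \notin S], then [m] dominates the Bernoulli law of parameter [q].
   The reduction approximates an increasing event from inside by countable
   intersections of cylinders; by compactness the upward closure of such an
   intersection is again the limit of increasing cylinder events. Two laws
   [nu] are used.

   When [p] is bounded away from [1], draw a uniformly random set [xi] of edges
   independently of the configuration, split it into clusters of edges at
   distance less than [k], and keep the clusters that are entirely open.
   Positive association bounds the probability that [S] and a further edge [e]
   are open below by [p] times the probability that [S] is open, and it shows
   that removing one edge from [xi] costs at most a constant factor in the
   probability that no cluster of [xi] is open; [k]-independence makes the
   clusters in [S] independent of the others.

   When [p] is close to [1], delete each open edge independently with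
   probability [d], where [1 - p] is a power of [d], and argue as Liggett,
   Schonmann and Stacey: by induction on the number of observed edges, an edge
   is open with conditional probability at least [1 - d].

   The upper bound is the lower bound for the complementary law. *)

Require Import Defs.
From mathcomp Require Import all_boot all_order all_algebra.
From mathcomp Require Import ring lra zify.

Set Implicit Arguments.
Unset Strict Implicit.
Unset Printing Implicit Defensive.

Import Order.TTheory GRing.Theory Num.Theory.
Local Open Scope ring_scope.

(** * Laws on the subsets of a finite set *)

Section weights.
Context (R : realFieldType) (I : finType).
Implicit Types (W S T U xi : {set I}) (e x : I) (A B : pred {set I})
  (nu : {set I} -> R) (f : {set I} -> R).

Definition up_closed A : Prop := forall W W', W \subset W' -> A W -> A W'.

Definition weight nu A : R := \sum_(W : {set I} | A W) nu W.

Lemma weightE nu A : weight nu A = \sum_W nu W * (A W)%:R.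
Proof.
by rewrite /weight big_mkcond; apply: eq_bigr => W _; case: (A W);
  rewrite (mulr1, mulr0).
Qed.

Lemma eq_weight nu A B : A =1 B -> weight nu A = weight nu B.
Proof. by move=> AB; exact: eq_bigl. Qed.

Lemma sum_setD1 e (F : {set I} -> R) :
  \sum_W F W = \sum_(W : {set I} | e \notin W) (F W + F (e |: W)).
Proof.
rewrite (bigID (fun W => e \notin W)) /= big_split /=; congr (_ + _).
rewrite (reindex_onto (fun W => e |: W) (fun W => W :\ e)) /=.
  apply: eq_bigl => W; rewrite negbK setU11 /=.
  apply/eqP/idP => [<-|eW]; first by rewrite setD11.
  by rewrite setU1K.
by move=> W; rewrite negbK => /setD1K.
Qed.

Definition bern (q : R) W : R := \prod_i (if i \in W then q else 1 - q).

Lemma sum_prod_set (a b : I -> R) :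
  \sum_(W : {set I}) \prod_i (if i \in W then a i else b i) = \prod_i (a i + b i).
Proof. by rewrite bigA_distr. Qed.

Lemma sum_bern q : \sum_W bern q W = 1.
Proof.
rewrite sum_prod_set big1// => i _; by rewrite addrC subrK.
Qed.

Lemma bern_setU1 q e W : e \notin W -> q * bern q W = (1 - q) * bern q (e |: W).
Proof.
move=> eW; rewrite /bern (bigD1 e)//= [in RHS](bigD1 e)//= setU11 (negbTE eW).
rewrite mulrCA; congr (_ * (_ * _)); apply: eq_bigr => i ie.
by rewrite !inE (negbTE ie).
Qed.

Definition increasing f : Prop := forall W W', W \subset W' -> f W <= f W'.

Definition set_avg (q : R) e f W : R := q * f (e |: W) + (1 - q) * f (W :\ e).

(** Pairing [W] with [e |: W] writes the effect of resampling [e] as the increment of [f] times the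
    defect of [nu] from the Bernoulli ratio, so its sign can be read off factor by factor. *)
Lemma sum_set_avg q nu e f :
  \sum_W nu W * f W - \sum_W nu W * set_avg q e f W =
  \sum_(W : {set I} | e \notin W)
     (f (e |: W) - f W) * ((1 - q) * nu (e |: W) - q * nu W).
Proof.
rewrite !(sum_setD1 e) -sumrB; apply: eq_bigr => W eW.
rewrite /set_avg setU1K// (_ : W :\ e = W); last first.
  by apply/setDidPl; rewrite disjoint_sym disjoints1.
rewrite setUA setUid; ring.
Qed.

Definition set_avgs q s f := foldr (set_avg q) f s.

Lemma set_avg_increasing q e f : 0 <= q <= 1 ->
  increasing f -> increasing (set_avg q e f).
Proof.
move=> /andP[q0 q1] fi W W' WW'; apply: lerD; apply: ler_wpM2l => //.
- by apply: fi; exact: setUS.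
- by rewrite subr_ge0.
- by apply: fi; exact: setSD.
Qed.

Lemma set_avgs_agree q s f W W' : (forall i, i \notin s -> (i \in W) = (i \in W')) ->
  set_avgs q s f W = set_avgs q s f W'.
Proof.
elim: s W W' => [|e s IH] W W' WW' /=.
  by congr f; apply/setP => i; exact: WW'.
congr (_ * _ + _ * _); apply: IH => i ies; rewrite !inE;
  by case: eqP => //= /eqP ie; apply: WW'; rewrite inE negb_or ie.
Qed.

(* Resampling one coordinate after the other from the Bernoulli law decreases
   the weight of an increasing function under [nu] and preserves it under
   [bern q]; once all of them are resampled, the function is constant. *)
Lemma bern_dominated (q : R) nu A : 0 <= q <= 1 ->
  (forall e S, e \notin S -> q * nu S <= (1 - q) * nu (e |: S)) ->
  up_closed A -> weight (bern q) A * \sum_S nu S <= weight nu A.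
Proof.
move=> q01 H upA; rewrite !weightE.
set f := fun W => (A W)%:R : R.
have fi : increasing f.
  move=> W W' WW'; rewrite /f ler_nat.
  by have := upA _ _ WW'; case: (A W) => // ->.
have fsi s : increasing (set_avgs q s f).
  by elim: s => //= e s; exact: set_avg_increasing.
have Hnu s : \sum_W nu W * set_avgs q s f W <= \sum_W nu W * f W.
  elim: s => //= e s; apply: le_trans; rewrite -subr_ge0 sum_set_avg.
  apply: sumr_ge0 => W eW; apply: mulr_ge0; rewrite subr_ge0.
    by apply: fsi; exact: subsetU1.
  exact: H.
have Hb s : \sum_W bern q W * set_avgs q s f W = \sum_W bern q W * f W.
  elim: s => //= e s <-; apply/eqP; rewrite eq_sym -subr_eq0 sum_set_avg.
  by rewrite big1// => W eW; rewrite (bern_setU1 q eW) subrr mulr0.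
rewrite -(Hb (enum I)); apply: le_trans (Hnu (enum I)).
have E W : set_avgs q (enum I) f W = set_avgs q (enum I) f set0.
  by apply: set_avgs_agree => i; rewrite mem_enum.
under eq_bigr do rewrite E.
under [leRHS]eq_bigr do rewrite E.
by rewrite -!mulr_suml sum_bern mul1r mulrC.
Qed.

End weights.

(* [m] is the law of the set of open elements of [I], and [near] is the
   relation outside of which the statuses are independent. *)
Record local_law (R : realFieldType) (I : finType) (near : rel I) (N : nat)
    (m : {set I} -> R) (p : R) : Prop := LocalLaw {
  near_sym : symmetric near;
  near_refl : reflexive near;
  near_card : forall x, (#|[set y | near x y]| <= N)%N;
  law_ge0 : forall W, 0 <= m W;
  law_sum : \sum_W m W = 1;
  law_assoc : forall A B : pred {set I}, up_closed A -> up_closed B ->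
    weight m A * weight m B <= weight m (predI A B);
  law_indep : forall F1 F2 : {set I},
    (forall x y, x \in F1 -> y \in F2 -> ~~ near x y) ->
    forall A1 A2 : pred {set I}, (forall W, A1 W = A1 (W :&: F1)) ->
      (forall W, A2 W = A2 (W :&: F2)) ->
    weight m (predI A1 A2) = weight m A1 * weight m A2;
  law_marginal : forall e, weight m (fun W => e \in W) = p;
  marginal01 : 0 <= p <= 1 }.

Section local_law_theory.
Context (R : realFieldType) (I : finType) (near : rel I) (N : nat).
Context (m : {set I} -> R) (p : R).
Implicit Types (W S T U xi : {set I}) (e x : I) (A B : pred {set I}).

Hypothesis mlaw : local_law near N m p.
Let near_sym := near_sym mlaw.
Let near_refl := near_refl mlaw.
Let near_card := near_card mlaw.
Let m_ge0 := law_ge0 mlaw.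
Let m_sum := law_sum mlaw.
Let assoc := law_assoc mlaw.
Let indep := law_indep mlaw.
Let marginal := law_marginal mlaw.
Let p01 := marginal01 mlaw.

Lemma weight_ge0 A : 0 <= weight m A.
Proof. by apply: sumr_ge0. Qed.

Lemma weight_le A B : (forall W, A W -> B W) -> weight m A <= weight m B.
Proof.
move=> AB; rewrite !weightE; apply: ler_sum => W _; apply: ler_wpM2l => //.
by rewrite ler_nat; have := AB W; case: (A W) => // ->.
Qed.

Lemma weightC A : weight m (predC A) = 1 - weight m A.
Proof.
apply/eqP; rewrite eq_sym subr_eq -m_sum addrC; apply/eqP.
by rewrite (bigID A).
Qed.

(** By inclusion-exclusion the complements have the same covariance as [A] and [B]. *)
Lemma assoc_down A B : up_closed A -> up_closed B ->
  weight m (predC A) * weight m (predC B) <= weight m (predI (predC A) (predC B)).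
Proof.
move=> uA uB.
have := assoc uA uB; rewrite !weightC => H.
have -> : weight m (predI (predC A) (predC B)) =
    1 - weight m A - weight m B + weight m (predI A B).
  rewrite -m_sum !weightE -sumrB -sumrB -big_split; apply: eq_bigr => W _ /=.
  case: (A W); case: (B W) => /=; ring.
lra.
Qed.

(** * Low density *)

(** The isolated subsets of [xi] are the unions of its [near]-clusters; this form avoids connected
    components. *)
Definition isolated xi S :=
  (S \subset xi) && [forall x in S, forall y in xi :\: S, ~~ near x y].

Lemma isolatedP xi S : reflect (S \subset xi /\
   forall x y, x \in S -> y \in xi -> y \notin S -> ~~ near x y) (isolated xi S).
Proof.
apply: (iffP andP) => -[Sxi H]; split => //.
  move=> x y xS yxi yS; have /forall_inP/(_ x xS)/forall_inP := H.
  by apply; rewrite inE yS.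
apply/forall_inP => x xS; apply/forall_inP => y; rewrite inE => /andP[yS yxi].
exact: H.
Qed.

Definition blocked xi W :=
  [forall S, isolated xi S ==> (S \subset W) ==> (S == set0)].

Lemma blockedP xi W : reflect (forall S, isolated xi S -> S \subset W -> S = set0)
  (blocked xi W).
Proof.
apply: (iffP forallP) => H S.
  by move=> iS SW; have := H S; rewrite iS SW => /eqP.
by apply/implyP => iS; apply/implyP => SW; rewrite (H S iS SW).
Qed.

Lemma blocked_setI xi W : blocked xi W = blocked xi (W :&: xi).
Proof.
apply/blockedP/blockedP => H S iS SW; apply: H => //.
  exact: subset_trans SW (subsetIl _ _).
by rewrite subsetI SW; have /isolatedP[] := iS.
Qed.

Lemma not_blocked_up xi : up_closed (predC (blocked xi)).
Proof.
move=> W W' WW' /=; apply: contra => /blockedP H; apply/blockedP => S iS SW.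
by apply: H => //; exact: subset_trans WW'.
Qed.

Definition all_open S := weight m (fun W => S \subset W).
Definition block_weight xi := weight m (blocked xi).

Lemma all_open_setU1 e S : p * all_open S <= all_open (e |: S).
Proof.
rewrite -(marginal e); apply: le_trans (assoc _ _) _.
- by move=> W W' /subsetP WW' /WW'.
- by move=> W W' WW' SW; exact: subset_trans WW'.
- by apply: weight_le => W /=; rewrite subUset sub1set.
Qed.

(** An open isolated subset of [xi] avoids the closed elements near [x], hence stays isolated when
    [x] joins [xi]. *)
Lemma blocked_setU1 x xi W : x \notin xi ->
  blocked (x |: xi) W -> [disjoint [set y | near x y] & W] -> blocked xi W.
Proof.
move=> xxi /blockedP H dW; apply/blockedP => S /isolatedP[Sxi iS] SW.
apply: H => //; apply/isolatedP; split.
  exact: subset_trans Sxi (subsetU1 _ _).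
move=> s y sS; rewrite !inE => /predU1P[->|]; last exact: iS.
move=> _; apply/negP => sx; have := subsetP SW _ sS.
by apply/negP; move: dW => /disjointFr ->//; rewrite inE near_sym.
Qed.

(** The elements of [S] are closed one at a time; each closure is a decreasing event of probability
    [1 - p], positively associated with what has been imposed before. *)
Lemma down_disjoint A S : up_closed A ->
  weight m (predC A) * (1 - p) ^+ #|S| <=
  weight m (predI (predC A) (fun W => [disjoint S & W])).
Proof.
move=> uA; elim: {S}_.+1 {-2}S (ltnSn #|S|) => // n IH S Sn.
have [->|[x xS]] := set_0Vmem S.
  rewrite cards0 expr0 mulr1; apply: weight_le => W /= ->.
  by rewrite -setI_eq0 set0I eqxx.
have := IH (S :\ x); rewrite (cardsD1 x) xS /= in Sn *.
move=> /(_ Sn) {}IH; rewrite add1n exprS mulrCA.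
have q0 : 0 <= 1 - p by rewrite subr_ge0; case/andP: p01.
apply: le_trans (ler_wpM2l q0 IH) _.
pose B W := A W || ~~ [disjoint S :\ x & W].
have -> : 1 - p = weight m (predC (fun W => x \in W)) by rewrite weightC marginal.
have E : predI (predC A) (fun W => [disjoint S :\ x & W]) =1 predC B.
  by move=> W; rewrite /= /B negb_or negbK.
rewrite (eq_weight _ E); apply: le_trans (assoc_down _ _) _.
- by move=> W W' /subsetP WW' /WW'.
- move=> W W' WW' /orP[/(uA _ _ WW')|h]; rewrite /B; first by move=> ->.
  apply/orP; right; apply: contra h; rewrite disjoint_sym => h.
  by rewrite disjoint_sym; apply: disjointWl h.
apply: weight_le => W /=; rewrite /B negb_or negbK => /and3P[xW -> /= dW].
by rewrite -(setD1K xS) -setI_eq0 setIUl setU_eq0 !setI_eq0 disjoints1 xW.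
Qed.

Section low_density.
Variable t : R.
Hypothesis tp : 1 <= t * (1 - p) ^+ N.

Let t0 : 0 <= t.
Proof.
have q0 : 0 <= (1 - p) ^+ N by rewrite exprn_ge0// subr_ge0; case/andP: p01.
by rewrite leNgt; apply/negP => t0; have := le_trans tp (mulr_le0_ge0 (ltW t0) q0); rewrite ler10.
Qed.

(** [down_disjoint] closes the at most [N] elements near [x]; once they are closed,
    [blocked (x |: xi)] implies [blocked xi]. *)
Lemma block_weight_setU1 x xi : x \notin xi ->
  block_weight (x |: xi) <= t * block_weight xi.
Proof.
move=> xxi.
have q0 : 0 <= 1 - p by rewrite subr_ge0; case/andP: p01.
have := down_disjoint [set y | near x y] (@not_blocked_up (x |: xi)).
rewrite (@eq_weight _ _ _ (predC (predC (blocked (x |: xi)))) (blocked (x |: xi))); last first.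
  by move=> W /=; rewrite negbK.
rewrite -/(block_weight _) => H.
have H2 : block_weight (x |: xi) * (1 - p) ^+ N <= block_weight xi.
  apply: le_trans (le_trans H _).
    rewrite ler_wpM2l ?weight_ge0//; apply: ler_wiXn2l => //.
    by case/andP: p01 => p0 p1; rewrite gerBl.
  by apply: weight_le => W /=; rewrite negbK => /andP[]; exact: blocked_setU1.
apply: le_trans (ler_wpM2l t0 H2).
by rewrite mulrCA ler_peMr// weight_ge0.
Qed.

(** [2 ^ #|U|] times the probability that no cluster of a uniformly random subset of [U] is open. *)
Definition blocked_sum U := \sum_(xi : {set I} | xi \subset U) block_weight xi.

Lemma blocked_sum_ge0 U : 0 <= blocked_sum U.
Proof. by apply: sumr_ge0 => xi _; exact: weight_ge0. Qed.

Lemma blocked_sum_setU1 x U : x \notin U ->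
  blocked_sum (x |: U) <= (1 + t) * blocked_sum U.
Proof.
move=> xU; rewrite /blocked_sum big_mkcond (sum_setD1 x) /=.
rewrite [in leRHS]big_mkcond (sum_setD1 x) /= mulr_sumr.
apply: ler_sum => xi xxi.
have E : (x |: xi \subset x |: U) = (xi \subset U).
  apply/idP/idP => [|/setUS->//] h.
  have := setSD [set x] h; rewrite setU1K// setU1K//.
rewrite E subUset sub1set (negbTE xU) /= addr0.
have -> : (xi \subset x |: U) = (xi \subset U).
  by rewrite -E subUset sub1set setU11.
case: ifP => _; last by rewrite addr0 mulr0.
by rewrite mulrDl mul1r lerD2l block_weight_setU1.
Qed.

Lemma blocked_sum_subset U U' : U' \subset U ->
  blocked_sum U <= (1 + t) ^+ #|U :\: U'| * blocked_sum U'.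
Proof.
elim: {U}_.+1 {-2}U (ltnSn #|U :\: U'|) => // n IH U Un UU'.
have [/eqP|[x xU]] := set_0Vmem (U :\: U').
  by rewrite setD_eq0 => h; rewrite (_ : U = U') ?setDv ?cards0 ?mul1r//;
    apply/eqP; rewrite eqEsubset h.
have UxU' : U' \subset U :\ x.
  by apply/subsetD1P; split => //; move: xU; rewrite inE => /andP[].
have E : (U :\ x) :\: U' = (U :\: U') :\ x by rewrite setDDl setUC -setDDl.
move: Un; rewrite (cardsD1 x) xU /= add1n ltnS => Un.
have := IH (U :\ x); rewrite E => /(_ Un UxU') {}IH.
move: xU; rewrite inE => /andP[_ xU]; rewrite exprS -mulrA.
apply: le_trans (ler_wpM2l _ IH); last by rewrite addr_ge0.
by rewrite -{1}(setD1K xU); apply: blocked_sum_setU1; rewrite setD11.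
Qed.

Definition far S := [set x | [forall s in S, ~~ near s x]].

(* [2 ^ #|I|] times the law of the union of those near-clusters of a uniformly
   random set [xi] that are fully open. *)
Definition open_clusters S : R :=
  \sum_(xi | isolated xi S)
    weight m (fun W => (S \subset W) && blocked (xi :\: S) W).

(** [S] is isolated exactly in the sets [S :|: xi] with [xi] contained in [far S]. Openness of [S]
    and blocking of [xi] then involve coordinates without near pairs, so their probabilities
    multiply. *)
Lemma open_clustersE S : open_clusters S = all_open S * blocked_sum (far S).
Proof.
rewrite /open_clusters /blocked_sum mulr_sumr.
rewrite (reindex_onto (fun xi => S :|: xi) (fun xi => xi :\: S)) /=; last first.
  move=> xi /isolatedP[/subsetP Sxi _]; apply/setP => x; rewrite !inE.
  by have := Sxi x; case: (x \in S) => //= ->.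
have E xi : isolated (S :|: xi) S && ((S :|: xi) :\: S == xi) = (xi \subset far S).
  apply/andP/subsetP => [[/isolatedP[_ H]] /eqP E x xxi|H].
    rewrite inE; apply/forall_inP => s sS; apply: H => //.
      by rewrite inE xxi orbT.
    by move: xxi; rewrite -E inE => /andP[].
  have dS x : x \in xi -> x \notin S.
    move=> /H; rewrite inE => /forall_inP h; apply/negP => xS.
    by have := h x xS; rewrite near_refl.
  split.
    apply/isolatedP; split; first exact: subsetUl.
    move=> x y xS; rewrite inE => /orP[->//|/H]; rewrite inE => /forall_inP h _.
    exact: h.
  apply/eqP/setP => x; rewrite !inE; case: (boolP (x \in xi)) => xxi.
    by rewrite dS ?orbT.
  by rewrite orbF andNb.
rewrite (eq_bigl _ _ E); apply: eq_bigr => xi /subsetP xiS.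
have dS : (S :|: xi) :\: S = xi.
  by apply/eqP; have := E xi; rewrite (introT subsetP xiS) => /andP[].
rewrite dS; apply: (indep (F1 := S) (F2 := xi)).
- by move=> x y xS /xiS; rewrite inE => /forall_inP; apply.
- by move=> W; rewrite subsetI subxx andbT.
- by move=> W; rewrite blocked_setI.
Qed.

(** Adding [e] costs a factor [p] in [all_open] by positive association and removes from [far S] at
    most the [N] elements near [e], each worth a factor [1 + t]. *)
Lemma open_clusters_ratio e S : e \notin S ->
  p * open_clusters S <= (1 + t) ^+ N * open_clusters (e |: S).
Proof.
move=> eS; rewrite !open_clustersE mulrA mulrCA.
have H1 := all_open_setU1 e S.
have H2 : blocked_sum (far S) <= (1 + t) ^+ N * blocked_sum (far (e |: S)).
  have sub : far (e |: S) \subset far S.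
    apply/subsetP => x; rewrite !inE => /forall_inP h; apply/forall_inP => s sS.
    by apply: h; rewrite inE sS orbT.
  apply: le_trans (blocked_sum_subset sub) _.
  rewrite ler_wpM2r ?blocked_sum_ge0//; apply: ler_weXn2l; first by rewrite lerDl.
  apply: leq_trans (near_card e); apply: subset_leq_card; apply/subsetP => x.
  rewrite !inE => /andP[/forall_inPn[s]]; rewrite !inE negbK.
  move=> /predU1P[->//|sS] nx /forall_inP/(_ s sS); by rewrite nx.
apply: ler_pM => //; rewrite ?blocked_sum_ge0//.
by rewrite mulr_ge0 ?weight_ge0//; case/andP: p01.
Qed.

Lemma isolatedD xi S S' : isolated xi S -> isolated (xi :\: S) S' -> isolated xi S'.
Proof.
move=> /isolatedP[Sxi iS] /isolatedP[S'xi iS']; apply/isolatedP; split.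
  exact: subset_trans S'xi (subsetDl _ _).
move=> x y xS' yxi yS'; have [yS|yS] := boolP (y \in S); last first.
  by apply: iS' => //; rewrite inE yS.
rewrite near_sym; apply: iS => //; have := subsetP S'xi x xS'; rewrite inE;
  by case/andP.
Qed.

(* The set in question is the union of all isolated subsets of [xi] contained
   in [W]. *)
Lemma open_clusters_unique xi W :
  {S0 : {set I} | (S0 \subset W) & forall S,
    [&& isolated xi S, S \subset W & blocked (xi :\: S) W] = (S == S0)}.
Proof.
pose S0 := \bigcup_(S | isolated xi S && (S \subset W)) S.
have S0W : S0 \subset W by apply/bigcupsP => S /andP[].
have iS0 : isolated xi S0.
  apply/isolatedP; split; first by apply/bigcupsP => S /andP[/isolatedP[]].
  move=> x y /bigcupP[S /andP[iS SW] xS] yxi yS0.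
  have /isolatedP[_ H] := iS; apply: H => //; apply: contra yS0 => yS.
  by apply/bigcupP; exists S => //; rewrite iS.
have maxS0 S : isolated xi S -> S \subset W -> S \subset S0.
  by move=> iS SW; apply: bigcup_sup; rewrite iS.
exists S0 => // S; apply/and3P/eqP => [[iS SW /blockedP bS]|->]; last first.
  split=> //; apply/blockedP => S' iS' S'W; apply/eqP.
  have := maxS0 _ (isolatedD iS0 iS') S'W; have /isolatedP[h _] := iS'.
  move=> /subsetP h'; rewrite -subset0; apply/subsetP => x xS'.
  by have := subsetP h x xS'; rewrite inE h'.
apply/eqP; rewrite eqEsubset maxS0//= -setD_eq0; apply/eqP; apply: bS.
  apply/isolatedP; split.
    by apply: setSD; have /isolatedP[] := iS0.
  move=> x y; rewrite !inE => /andP[xS xS0] /andP[yS yxi]; rewrite yS /= => yS0.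
  by have /isolatedP[_ ] := iS0; apply.
exact: subset_trans (subsetDl _ _) S0W.
Qed.

(** For each pair [W], [xi] exactly one [S] is counted, so [open_clusters] is the image of [m] times
    counting measure under a map whose value lies inside [W]. *)
Lemma sum_open_clusters A : weight open_clusters A =
  \sum_W m W * \sum_(xi : {set I}) (A (s2val (open_clusters_unique xi W)))%:R.
Proof.
rewrite /weight /open_clusters.
under eq_bigr do under eq_bigr do rewrite weightE.
under eq_bigr do rewrite exchange_big.
rewrite exchange_big /=; apply: eq_bigr => W _.
under eq_bigr do rewrite -mulr_sumr.
rewrite -mulr_sumr; congr (_ * _).
rewrite (exchange_big_dep predT) //=; apply: eq_bigr => xi _.
case: (open_clusters_unique xi W) => S0 /= S0W H.
rewrite big_mkcondr /= [LHS]big_mkcond /= (bigD1 S0)//= big1 ?addr0.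
  have := H S0; rewrite eqxx => /and3P[-> -> ->] /=.
  by case: (A S0).
move=> S SS0; have := H S; rewrite (negbTE SS0).
by case: (isolated xi S) => /= [->|]; case: (A S).
Qed.

(** The union of the open clusters lies inside [W], so [m] dominates the normalised [open_clusters];
    [open_clusters_ratio] and the condition on [q] supply the hypothesis of [bern_dominated]. *)
Lemma low_density_bound (q : R) A : up_closed A -> 0 <= q <= 1 ->
  q * (1 + t) ^+ N <= (1 - q) * p -> weight (bern q) A <= weight m A.
Proof.
move=> uA q01 qp.
set c : R := \sum_(xi : {set I}) 1.
have c0 : 0 < c.
  by rewrite /c (bigD1 set0)//= ltr_pwDl// sumr_ge0.
have H e S : e \notin S -> q * open_clusters S <= (1 - q) * open_clusters (e |: S).
  move=> eS; have tN : 0 < (1 + t) ^+ N by rewrite exprn_gt0// ltr_wpDr.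
  rewrite -(ler_pM2l tN) mulrCA mulrA.
  have o0 : 0 <= open_clusters S by apply: sumr_ge0 => ? _; exact: weight_ge0.
  apply: le_trans (ler_wpM2r o0 qp) _; rewrite -mulrA [leRHS]mulrCA.
  apply: ler_wpM2l; last exact: open_clusters_ratio.
  by rewrite subr_ge0; case/andP: q01.
have := bern_dominated q01 H uA.
have -> : \sum_S open_clusters S = c.
  transitivity (weight open_clusters predT); first by [].
  by rewrite sum_open_clusters /= -mulr_suml m_sum mul1r.
move=> h; rewrite -(ler_pM2r c0); apply: le_trans h _.
rewrite sum_open_clusters weightE mulr_suml; apply: ler_sum => W _.
rewrite -mulrA; apply: ler_wpM2l => //; rewrite mulr_sumr; apply: ler_sum => xi _.
case: (open_clusters_unique xi W) => S0 /= S0W _; rewrite mulr1 ler_nat.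
by have := uA _ _ S0W; case: (A S0) => // ->.
Qed.

End low_density.

(** * High density *)

Section high_density.
(** [d] is the deletion probability. In the exponent of [pd], [N] factors pay for the elements of
    [S] near [e], [N] for those of [T], and one is left as the bound in [thin_setU1l]. *)
Variable d : R.
Hypothesis d_ge0 : 0 <= d.
Hypothesis d_le : d <= 1 - d.
Hypothesis pd : 1 - p = d ^+ (N + N).+1.

(* The probability that [S] is open and that [T] is closed after deleting each
   open edge of [T] with probability [d]. *)
Definition thin S T := \sum_W m W * ((S \subset W)%:R * d ^+ #|T :&: W|).

Let d_le1 : d <= 1. Proof. by move: d_ge0 d_le; lra. Qed.

Lemma thin_ge0 S T : 0 <= thin S T.
Proof. by apply: sumr_ge0 => W _; rewrite !mulr_ge0// exprn_ge0. Qed.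

Lemma thin_split e S T : e \notin T ->
  thin S T = (1 - d) * thin (e |: S) T + thin S (e |: T).
Proof.
move=> eT; rewrite /thin mulr_sumr -big_split; apply: eq_bigr => W _ /=.
rewrite subUset sub1set setIUl; case: (boolP (e \in W)) => eW /=.
  have /setIidPl -> : [set e] \subset W by rewrite sub1set.
  rewrite cardsU1 inE (negbTE eT) /= exprS; ring.
have -> : [set e] :&: W = set0.
  by apply/eqP; rewrite setI_eq0 disjoints1.
by rewrite set0U mul0r !mulr0 add0r.
Qed.

Lemma thin_setU1r e S T : d * thin S T <= thin S (e |: T).
Proof.
rewrite /thin mulr_sumr; apply: ler_sum => W _; rewrite mulrCA.
apply: ler_wpM2l => //; rewrite mulrCA; apply: ler_wpM2l => //.
rewrite -exprS; apply: ler_wiXn2l => //.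
rewrite setIUl; apply: leq_trans (leq_card_setU _ _) _.
rewrite -add1n leq_add2r; apply: leq_trans (subset_leq_card (subsetIl _ _)) _.
by rewrite cards1.
Qed.

(** Decomposing over the values [V] of the trace on [F2] turns a function of the trace into events,
    to which [law_indep] applies. *)
Lemma sum_trace (F1 : pred {set I}) (F2 : {set I}) (h : {set I} -> R) :
  \sum_W m W * ((F1 W)%:R * h (W :&: F2)) =
  \sum_V h V * weight m (predI F1 (fun W => W :&: F2 == V)).
Proof.
under [RHS]eq_bigr do rewrite weightE mulr_sumr.
rewrite exchange_big /=; apply: eq_bigr => W _.
rewrite (bigD1 (W :&: F2))//= eqxx andbT big1 ?addr0; first by ring.
by move=> V; rewrite eq_sym => /negbTE ->; rewrite andbF !mulr0.
Qed.

Lemma closed_thin_far e S T : (forall x, x \in S :|: T -> ~~ near e x) ->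
  \sum_W m W * ((e \notin W)%:R * ((S \subset W)%:R * d ^+ #|T :&: W|)) =
  (1 - p) * thin S T.
Proof.
move=> H.
pose h (V : {set I}) : R := (S \subset V)%:R * d ^+ #|T :&: V|.
have hE W : (S \subset W)%:R * d ^+ #|T :&: W| = h (W :&: (S :|: T)).
  rewrite /h subsetI subsetUl andbT; congr (_ * _ ^+ #|pred_of_set _|).
  by rewrite setICA (setIidPl (subsetUr S T)) setIC.
under eq_bigr do rewrite hE.
rewrite (sum_trace (fun W => e \notin W)).
have -> : thin S T = \sum_W m W * ((predT W)%:R * h (W :&: (S :|: T))).
  by apply: eq_bigr => W _; rewrite hE mul1r.
rewrite (sum_trace predT) mulr_sumr; apply: eq_bigr => V _.
rewrite mulrCA; congr (_ * _).
rewrite (indep (F1 := [set e]) (F2 := S :|: T)).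
- by rewrite [X in X * _](weightC (fun W => e \in W)) marginal.
- by move=> x y /set1P ->; exact: H.
- by move=> W; rewrite !inE eqxx andbT.
- by move=> W; rewrite -setIA setIid.
Qed.

(** In conditional terms, [e] is open with probability at least [1 - d] given that [S] is open and
    [T] is closed after deletion. By independence, [e] closed together with the far conditions has
    weight [(1 - p) * thin (S :\: F) (T :\: F)]; restoring the near conditions costs at most
    [d ^+ (N + N)], and [pd] leaves one factor [d]. *)
Lemma thin_setU1l e S T : (1 - d) * thin S T <= thin (e |: S) T.
Proof.
elim: {S T}_.+1 {-2}S {-2}T (ltnSn (#|S| + #|T|)) e => // n IH S T STn e.
pose F := [set y | near e y].
have near_part : d ^+ (N + N) * thin (S :\: F) (T :\: F) <= thin S T.
  (* Near elements of [S'] are restored one by one: the induction hypothesis for the smaller set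
     gives a factor [1 - d], which is at least [d]. *)
  have partS k S' T' : (#|S'| + #|T'| <= n)%N ->
      (#|S' :&: F| <= k)%N -> d ^+ k * thin (S' :\: F) T' <= thin S' T'.
    elim: k S' => [|k IHk] S' Sn Sk.
      rewrite expr0 mul1r; move: Sk; rewrite leqn0 cards_eq0 setI_eq0.
      by move=> /setDidPl ->.
    have [SF|[x xSF]] := set_0Vmem (S' :&: F).
      rewrite (_ : S' :\: F = S'); last by apply/setDidPl; rewrite -setI_eq0 SF.
      by apply: ler_piMl; rewrite ?thin_ge0// exprn_ile1.
    have [xS xF] : x \in S' /\ x \in F by move: xSF; rewrite inE => /andP[].
    have E : (S' :\ x) :&: F = (S' :&: F) :\ x by rewrite setIDAC.
    rewrite (cardsD1 x) xSF add1n ltnS in Sk.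
    have cS := cardsD1 x S'; rewrite xS add1n in cS.
    have := IHk (S' :\ x); rewrite E => /(_ _ Sk).
    have -> : (S' :\ x) :\: F = S' :\: F.
      by rewrite setDDl; congr (_ :\: _); apply/setUidPr; rewrite sub1set.
    move=> /(_ _)/= h; rewrite exprS -mulrA.
    have {}h := h ltac:(lia).
    apply: le_trans (ler_wpM2l d_ge0 h) _.
    apply: le_trans (ler_wpM2r (thin_ge0 _ _) d_le) _.
    rewrite -{2}(setD1K xS); apply: IH; lia.
  have partT k T' : (#|T' :&: F| <= k)%N ->
      d ^+ k * thin S (T' :\: F) <= thin S T'.
    elim: k T' => [|k IHk] T' Tk.
      rewrite expr0 mul1r; move: Tk; rewrite leqn0 cards_eq0 setI_eq0.
      by move=> /setDidPl ->.
    have [TF|[x xTF]] := set_0Vmem (T' :&: F).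
      rewrite (_ : T' :\: F = T'); last by apply/setDidPl; rewrite -setI_eq0 TF.
      by apply: ler_piMl; rewrite ?thin_ge0// exprn_ile1.
    have [xT xF] : x \in T' /\ x \in F by move: xTF; rewrite inE => /andP[].
    have E : (T' :\ x) :&: F = (T' :&: F) :\ x by rewrite setIDAC.
    rewrite (cardsD1 x) xTF add1n ltnS in Tk.
    have := IHk (T' :\ x); rewrite E => /(_ Tk).
    have -> : (T' :\ x) :\: F = T' :\: F.
      by rewrite setDDl; congr (_ :\: _); apply/setUidPr; rewrite sub1set.
    move=> h; rewrite exprS -mulrA.
    apply: le_trans (ler_wpM2l d_ge0 h) _.
    by rewrite -{2}(setD1K xT); exact: thin_setU1r.
  have FN U : (#|U :&: F| <= N)%N.
    by apply: leq_trans (near_card e); apply: subset_leq_card; exact: subsetIr.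
  rewrite exprD -mulrA.
  apply: le_trans (partT N T (FN T)).
  apply: ler_wpM2l; first by rewrite exprn_ge0.
  apply: partS => //; move: STn; rewrite ltnS; apply: leq_trans.
  by rewrite leq_add2l subset_leq_card// subsetDl.
(* Dropping the conditions near [e] only increases the sum, and what remains is independent of
   [e]. *)
have far_part : \sum_W m W * ((e \notin W)%:R * ((S \subset W)%:R * d ^+ #|T :&: W|))
    <= (1 - p) * thin (S :\: F) (T :\: F).
  rewrite -(@closed_thin_far e); last first.
    by move=> x; rewrite !inE => /orP[] /andP[].
  apply: ler_sum => W _; apply: ler_wpM2l => //; apply: ler_wpM2l => //.
  apply: ler_pM => //; first by rewrite exprn_ge0.
    rewrite ler_nat; case: (boolP (S \subset W)) => // SW.
    by rewrite (subset_trans _ SW)// subsetDl.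
  apply: ler_wiXn2l => //; apply: subset_leq_card.
  by apply: setSI; exact: subsetDl.
have splitE : thin S T = thin (e |: S) T +
    \sum_W m W * ((e \notin W)%:R * ((S \subset W)%:R * d ^+ #|T :&: W|)).
  rewrite /thin -big_split; apply: eq_bigr => W _ /=.
  by rewrite subUset sub1set; case: (e \in W) => /=; ring.
have : \sum_W m W * ((e \notin W)%:R * ((S \subset W)%:R * d ^+ #|T :&: W|))
    <= d * thin S T.
  apply: le_trans far_part _; rewrite pd exprS -mulrA.
  exact: ler_wpM2l.
by move=> h; rewrite mulrBl mul1r lerBlDr {1}splitE lerD2l.
Qed.

(** Law of the set of elements surviving deletion: those of [S] are open and kept, all others end up
    closed. *)
Definition thinned S := (1 - d) ^+ #|S| * thin S (~: S).

Lemma sum_subset_binomial W :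
  \sum_(S : {set I}) (1 - d) ^+ #|S| * ((S \subset W)%:R * d ^+ #|~: S :&: W|) = 1.
Proof.
pose a i : R := (1 - d) * (i \in W)%:R.
pose b i : R := if i \in W then d else 1.
transitivity (\sum_(S : {set I}) \prod_i (if i \in S then a i else b i)); last first.
  rewrite sum_prod_set big1// => i _; rewrite /a /b; case: (i \in W) => /=; ring.
apply: eq_bigr => S _; rewrite (bigID (fun i => i \in S)) /= mulrA; congr (_ * _).
  under eq_bigr => i iS do rewrite iS.
  rewrite /a big_split /= prodr_const; congr (_ * _).
  have [/subsetP SW|/subsetPn[x xS xW]] := boolP (S \subset W).
    by rewrite big1// => i /SW ->.
  by rewrite (bigD1 x)//= (negbTE xW) mul0r.
under eq_bigr => i /negbTE iS do rewrite iS.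
rewrite /b -big_mkcondr prodr_const; congr (d ^+ _).
by apply: eq_card => i; rewrite !inE.
Qed.

(** The survivors form a subset of [W]. A further element is open with conditional probability at
    least [1 - d] and is then kept with probability [1 - d], whence the square. *)
Lemma high_density_bound (q : R) A : up_closed A -> 0 <= q <= 1 ->
  q <= (1 - d) ^+ 2 -> weight (bern q) A <= weight m A.
Proof.
move=> uA q01 qd.
have d1 : 0 <= 1 - d by rewrite subr_ge0.
have thinnedE A' : weight thinned A' = \sum_W m W * \sum_(S | A' S)
    (1 - d) ^+ #|S| * ((S \subset W)%:R * d ^+ #|~: S :&: W|).
  rewrite /weight /thinned; under eq_bigr do rewrite mulr_sumr.
  rewrite exchange_big /=; apply: eq_bigr => W _; rewrite mulr_sumr.
  by apply: eq_bigr => S _; rewrite mulrCA.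
have H e S : e \notin S -> q * thinned S <= (1 - q) * thinned (e |: S).
  move=> eS; rewrite /thinned.
  have eT : e \notin ~: (e |: S) by rewrite !inE eqxx.
  have -> : ~: S = e |: ~: (e |: S).
    by apply/setP => x; rewrite !inE; case: eqP => //= ->.
  have E := thin_split S eT.
  have L := thin_setU1l e S (~: (e |: S)).
  have g0 := thin_ge0 (e |: S) (~: (e |: S)).
  have f0 := thin_ge0 S (~: (e |: S)).
  rewrite cardsU1 eS add1n exprS.
  set k := (1 - d) ^+ #|S|; set u := thin S (e |: _) in E *.
  set v := thin (e |: S) _ in E L g0 *; set w := thin S (~: _) in E L f0.
  rewrite (_ : q * _ = k * (q * u)); last by ring.
  rewrite (_ : _ * (_ * k * v) = k * ((1 - q) * (1 - d) * v)); last by ring.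
  apply: ler_wpM2l; first by rewrite exprn_ge0.
  have -> : u = w - (1 - d) * v by rewrite E addrC addKr.
  have : q * w <= (1 - d) * v.
    apply: le_trans (ler_wpM2r f0 qd) _; rewrite expr2 -mulrA.
    exact: ler_wpM2l.
  by lra.
have := bern_dominated q01 H uA.
have -> : \sum_S thinned S = 1.
  transitivity (weight thinned predT); first by [].
  rewrite thinnedE; under eq_bigr do rewrite sum_subset_binomial mulr1.
  exact: m_sum.
rewrite mulr1 => /le_trans; apply; rewrite thinnedE weightE.
apply: ler_sum => W _; apply: ler_wpM2l => //.
have -> : (A W)%:R = \sum_(S : {set I})
    (A W)%:R * ((1 - d) ^+ #|S| * ((S \subset W)%:R * d ^+ #|~: S :&: W|)).
  by rewrite -mulr_sumr sum_subset_binomial mulr1.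
rewrite big_mkcond.
apply: ler_sum => S _; case: ifP => AS; last by rewrite !mulr_ge0// exprn_ge0.
case: (boolP (S \subset W)) => [SW|]; last by rewrite !(mul0r, mulr0).
by rewrite (uA _ _ SW AS) !mul1r.
Qed.

End high_density.

(** One rate serves both regimes. If [d <= 1 - d], the high density bound asks only for exponent
    two. Otherwise [d] exceeds one half, so [t = 2 ^+ (L * N)] is admissible at low density, and
    [(1 + t) ^+ N] is at most [2 ^+ K], which the power of [1 - d] absorbs. *)
Lemma bern_root_bound (d : R) A : up_closed A ->
  0 <= d -> 1 - p = d ^+ (N + N).+1 ->
  weight (bern ((1 - d) ^+ (N * ((N + N).+1 * N).+1).+2)) A <= weight m A.
Proof.
move=> uA d0 pd; set L := (N + N).+1 in pd *; set K := (N * (L * N).+1)%N.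
have /andP[p0 p1] := p01.
have d1 : d <= 1 by rewrite -(@expr_le1 _ L)// -pd gerBl.
have q0 : 0 <= 1 - d by rewrite subr_ge0.
have q1 : 1 - d <= 1 by rewrite gerBl.
have q01 : 0 <= (1 - d) ^+ K.+2 <= 1 by rewrite exprn_ge0// exprn_ile1.
have [dh|dh] := leP d (1 - d).
  by apply: (high_density_bound d0 dh pd uA q01); exact: ler_wiXn2l.
have dp : 1 - d <= p.
  have : d ^+ L <= d by rewrite exprS ler_piMr// exprn_ile1.
  by rewrite -pd; lra.
have tp : 1 <= 2 ^+ (L * N) * (1 - p) ^+ N.
  rewrite pd exprM -exprMn -exprMn -exprM exprn_ege1//; lra.
apply: (low_density_bound tp uA q01).
have HK : (1 - d) ^+ K.+1 * 2 ^+ K.+1 <= 1.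
  rewrite -exprMn exprn_ile1//; lra.
have tK : (1 + 2 ^+ (L * N)) ^+ N <= 2 ^+ K :> R.
  rewrite /K [(N * _)%N]mulnC [leRHS]exprM; apply: lerXn2r; rewrite ?nnegrE ?addr_ge0 ?exprn_ge0//.
  rewrite exprS (_ : 2 * _ = 2 ^+ (L * N) + 2 ^+ (L * N)); last by ring.
  by rewrite lerD2r exprn_ege1// ler1n.
(* Of the two exponents beyond [K], one is compared with [p] and the other gains the factor one half
   that matches [1 - q >= 1 / 2]. *)
have qp : (1 - d) ^+ K.+2 * 2 ^+ K <= p / 2.
  rewrite ler_pdivlMr// -mulrA -exprSr exprS -mulrA.
  by apply: le_trans dp; rewrite ler_piMr.
have qh : (1 - d) ^+ K.+2 <= 1 / 2.
  apply: (@le_trans _ _ (1 - d)); last by lra.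
  by rewrite exprS ler_piMr// exprn_ile1.
have := ler_wpM2l (proj1 (andP q01)) tK.
move=> h; apply: le_trans (le_trans h qp) _.
by rewrite mulrC; apply: ler_wpM2r => //; lra.
Qed.

End local_law_theory.

(** * Exchange of open and closed, and the upper bound *)

Section complement.
Context (R : realFieldType) (I : finType).
Implicit Types (W : {set I}) (A : pred {set I}) (nu : {set I} -> R).

Lemma weight_setC nu A : weight (fun W => nu (~: W)) A = weight nu (fun W => A (~: W)).
Proof.
rewrite /weight [RHS](reindex_inj (inv_inj (@setCK _))) /=.
by apply: eq_bigl => W; rewrite setCK.
Qed.

Lemma bern_setC q W : bern q (~: W) = bern (1 - q) W :> R.
Proof.
apply: eq_bigr => i _; rewrite inE; case: (i \in W) => //=.
by rewrite opprB addrC subrK.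
Qed.

Lemma up_closedCC A : up_closed A -> up_closed (fun W => ~~ A (~: W)).
Proof.
move=> uA W W' WW'; apply: contra; apply: uA.
by rewrite setCS.
Qed.

Lemma local_lawC (near : rel I) N (m : {set I} -> R) p :
  local_law near N m p -> local_law near N (fun W => m (~: W)) (1 - p).
Proof.
move=> H; split; try by case: H.
- exact: etrans (weight_setC m predT) (law_sum H).
- move=> A B uA uB; rewrite !weight_setC.
  have := assoc_down H (up_closedCC uA) (up_closedCC uB).
  by congr (_ * _ <= _); apply: eq_weight => W /=; rewrite !negbK.
- move=> F1 F2 far A1 A2 h1 h2; rewrite !weight_setC.
  have sub W F : ~: (W :&: F) :&: F = ~: W :&: F.
    by apply/setP => x; rewrite !inE; case: (x \in F); rewrite ?(andbT, andbF).
  apply: (law_indep H far) => W /=.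
    by rewrite h1 [RHS]h1 sub.
  by rewrite h2 [RHS]h2 sub.
- move=> e; rewrite weight_setC -(law_marginal H e) -(weightC H).
  by apply: eq_weight => W; rewrite /= inE.
- by have /andP[p0 p1] := marginal01 H; rewrite subr_ge0 p1 gerBl.
Qed.

(** The lower bound is applied to the complementary law, of marginal [1 - p], and to the increasing
    event that the complement lies outside [A]; passing to the opposite event reverses the
    inequality. *)
Lemma bern_root_bound_dual (near : rel I) N (m : {set I} -> R) (p d : R) A :
  local_law near N m p -> up_closed A ->
  0 <= d -> p = d ^+ (N + N).+1 ->
  weight m A <= weight (bern (1 - (1 - d) ^+ (N * ((N + N).+1 * N).+1).+2)) A.
Proof.
move=> H uA d0 pd; set q := (1 - d) ^+ _.
have := bern_root_bound (local_lawC H) (up_closedCC uA) d0.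
rewrite opprB addrC subrK => /(_ pd); rewrite -/q.
have sC nu : \sum_W nu W = 1 -> weight nu (fun W => ~~ A (~: W)) =
    1 - weight (fun W => nu (~: W)) A.
  move=> nu1; rewrite weight_setC; apply/eqP; rewrite eq_sym subr_eq -nu1.
  by rewrite [X in X == _](bigID (fun W => A (~: W))) /= addrC.
rewrite (sC _ (sum_bern _ _)) (sC _ (law_sum (local_lawC H))).
rewrite lerD2l lerN2.
have -> : weight (fun W => m (~: ~: W)) A = weight m A.
  by apply: eq_bigr => W _; rewrite setCK.
have -> : weight (fun W => bern q (~: W)) A = weight (bern (1 - q)) A.
  by apply: eq_bigr => W _; rewrite bern_setC.
by [].
Qed.

End complement.

From mathcomp Require Import finmap.
From mathcomp Require Import all_classical all_reals all_analysis.
Import numFieldNormedType.Exports.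
Local Open Scope classical_set_scope.
Local Open Scope ring_scope.

(** * From cylinder events to increasing functions *)

Section cylinders.
Context (I : choiceType).
Local Notation C := (I -> bool).
Implicit Types (A B K L : set C) (F : nat -> set C).

(** Splitting on the first coordinate of the list leaves two sets determined by the remaining
    ones. *)
Lemma determined_sigma (D : set I) (s : seq I) A : (forall i, i \in s -> D i) ->
  determined s A -> <<s open_events D >> A.
Proof.
have sigD : sigma_algebra setT <<s open_events D >>.
  exact: smallest_sigma_algebra.
pose T := g_sigma_algebraType (open_events D).
suff : forall A : set T, (forall i, i \in s -> D i) -> determined s (A : set C) ->
  measurable A by move=> H; exact: H.
elim: s => [|i s IH] {}A sD dA.
  have [[w Aw]|nA] := pselect (exists w, A w).
    rewrite (_ : A = setT)//; apply/seteqP; split => // v _.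
    by rewrite (dA v w).
  rewrite (_ : A = set0)//; apply/seteqP; split => // v Av.
  by case: nA; exists v.
pose Ab b : set T := [set w | A (upd w i b)].
have mAb b : measurable (Ab b).
  apply: IH => [j js|w w' ww']; first by apply: sD; rewrite inE js orbT.
  apply: dA => j; rewrite inE /upd; case: eqP => //= _; exact: ww'.
have mi : measurable (open_event i : set T).
  by apply: sub_sigma_algebra; exists i => //; apply: sD; rewrite inE eqxx.
have updE (w : C) : upd w i (w i) = w.
  by apply/funext => j; rewrite /upd; case: eqP => // ->.
rewrite (_ : A = (open_event i `&` Ab true) `|` (~` open_event i `&` Ab false)).
  apply: measurableU; apply: measurableI => //; exact: measurableC.
apply/seteqP; split => [w Aw|w].
  case: (boolP (w i)) => wi; [left|right]; split => //.
  - by rewrite /Ab /= -wi updE.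
  - exact/negP.
  - by rewrite /Ab /= -(negbTE wi) updE.
case=> -[]; rewrite /open_event /Ab /= => wi.
  by rewrite -[X in upd w i X]wi updE.
by move/negP/negbTE: wi => wi; rewrite -[X in upd w i X]wi updE.
Qed.

Lemma cylinder_measurable A : cylinder A -> measurable (A : set (config I)).
Proof. by move=> [s dA]; exact: (@determined_sigma setT s). Qed.

(** Stand-in for compact sets: closed in the product topology, yet always measurable, which closed
    sets need not be when [I] is uncountable. *)
Definition closed_cylinders K : Prop :=
  exists2 F : nat -> set C, (forall n, cylinder (F n)) & K = \bigcap_n F n.

Lemma cylinderI A B : cylinder A -> cylinder B -> cylinder (A `&` B).
Proof.
move=> cA cB; rewrite -(setCK (A `&` B)) setCI; apply: cylinderC.
by apply: cylinderU; exact: cylinderC.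
Qed.

Lemma cylinderT : cylinder [set: C].
Proof. by exists [::]. Qed.

Lemma closed_cylinders_countable (T : countType) (F : T -> set C) :
  (forall t, cylinder (F t)) -> closed_cylinders (\bigcap_t F t).
Proof.
move=> cF; exists (fun n => if choice.unpickle n is Some t then F t else setT).
  by move=> n; case: choice.unpickle => // *; exact: cylinderT.
apply/seteqP; split => w Fw.
  by move=> n _; case E: (choice.unpickle n) => [t|//]; exact: Fw.
by move=> t _; have := Fw (choice.pickle t) Logic.I; rewrite choice.pickleK.
Qed.

Lemma cylinder_closed A : cylinder A -> closed_cylinders A.
Proof.
move=> cA; exists (fun=> A) => //.
by apply/seteqP; split => w; [move=> Aw n | move=> /(_ 0%N Logic.I)].
Qed.

Lemma closed_cylindersU K L : closed_cylinders K -> closed_cylinders L ->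
  closed_cylinders (K `|` L).
Proof.
move=> [F cF ->] [G cG ->].
rewrite (_ : _ `|` _ = \bigcap_(nm : nat * nat) (F nm.1 `|` G nm.2)).
  by apply: closed_cylinders_countable => nm; exact: cylinderU.
apply/seteqP; split => w.
  by case=> Hw nm _; [left|right]; exact: Hw.
move=> Hw; apply: contrapT => /not_orP[/existsNP[n /not_implyP[_ Fn]]].
by move=> /existsNP[k /not_implyP[_ Gk]]; case: (Hw (n, k) Logic.I).
Qed.

Lemma closed_cylinders_bigcap (K : nat -> set C) :
  (forall n, closed_cylinders (K n)) -> closed_cylinders (\bigcap_n K n).
Proof.
move=> cK; have [F cF KF] : exists2 F : nat -> nat -> set C,
    (forall n k, cylinder (F n k)) & forall n, K n = \bigcap_k F n k.
  have /choice[F HF] : forall n, exists F : nat -> set C,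
      (forall k, cylinder (F k)) /\ K n = \bigcap_k F k.
    by move=> n; have [F] := cK n; exists F.
  by exists F => n; [move=> k|]; have [] := HF n.
rewrite (_ : \bigcap_n K n = \bigcap_(nk : nat * nat) F nk.1 nk.2).
  exact: closed_cylinders_countable.
apply/seteqP; split => w Hw.
  by move=> [n k] _ /=; have := Hw n Logic.I; rewrite KF; apply.
by move=> n _; rewrite KF => k _; exact: (Hw (n, k)).
Qed.

Lemma closed_cylinders_measurable K : closed_cylinders K ->
  measurable (K : set (config I)).
Proof.
move=> [F cF ->]; apply: (@bigcapT_measurable _ (config I)) => n.
exact: cylinder_measurable.
Qed.

Definition up_closure A : set C := [set w | exists2 v, A v & config_le v w].

Lemma cylinder_up_closure A : cylinder A -> cylinder (up_closure A).
Proof.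
suff H s : determined s A -> forall w w', {in s, w =1 w'} ->
    up_closure A w -> up_closure A w'.
  move=> [s dA]; exists s => w w' ww'; apply/propext; split; apply: (H s dA) => //.
  by move=> i /ww'.
(* The witness is closed outside [s]: it stays in [A] and lies below any configuration agreeing with
   [w] on [s]. *)
move=> dA w w' ww' [v Av vw]; exists (fun i => (i \in s) && v i).
  by rewrite (dA _ v)// => i ->.
by move=> i; case: (boolP (i \in s)) => //= /ww' <-; exact: vw.
Qed.

(** If [w] were outside [A], every [v] would leave some [F n] or fail to be below [w], so these open
    sets would cover the compact cube. A finite subcover contradicts that [w] lies in the up-closure
    of the [F n] of largest index. *)
Lemma up_closure_bigcap F A : (forall n, cylinder (F n)) -> nonincreasing_seq F ->
  \bigcap_n F n `<=` A -> (forall w w', A w -> config_le w w' -> A w') ->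
  \bigcap_n up_closure (F n) `<=` A.
Proof.
move=> cF dF FA upA w Hw; apply: contrapT => nAw.
pose K := cube I.
have cT : compact [set: K].
  rewrite (_ : setT = [set f : K | forall i, [set: bool] (f i)]).
    by have := @tychonoff I (fun=> bool) (fun=> setT) (fun=> bool_compact).
  by apply/seteqP; split.
move: cT; rewrite compact_cover => /(_ nat setT
  (fun n => ~` F n `|` [set v | ~ config_le v w] : set K)); case.
- move=> n _; apply: openU; first by apply: cylinder_open; exact: cylinderC.
  rewrite (_ : [set v | _] = \bigcup_i [set v : K | v i && ~~ w i]).
    apply: bigcup_open => i _; apply: cylinder_open; exists [:: i] => v v' vv'.
    by rewrite /mkset vv'// inE.
  apply/seteqP; split => v.
    move=> /existsNP[i vi]; exists i => //=.
    by move: vi; case: (v i); case: (w i) => //= /(_ isT).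
  move=> [i _ /= /andP[vi wi]] /(_ i).
  by rewrite vi (negbTE wi).
- move=> v _; apply: contrapT => H; apply: nAw.
  have H' n : F n v /\ config_le v w.
    by apply: contrapT => /not_andP h; apply: H; exists n.
  by apply: (upA v); [apply: FA => n _; case: (H' n)|case: (H' 0%N)].
move=> D _ cD.
have [v FNv vw] := Hw (\max_(n <- D) n)%N Logic.I.
have [n Dn [|]] := cD v Logic.I => //; apply.
have /dF/subsetPset : (n <= \max_(n <- D) n)%O.
  rewrite leEnat (big_rem n)//= leq_maxl//.
by apply.
Qed.

End cylinders.

(** * Inner approximation and domination through events *)

Section domination.
Context (R : realType) (I : choiceType).
Local Notation C := (config I).
Implicit Types (P Q : percolation R I) (A : set C).
Local Open Scope ereal_scope.

(** Both [A] and its complement are approximated from inside, so that the property is stable under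
    complement. *)
Definition approximable P A : Prop := forall e : R, (0 < e)%R ->
  exists K L : set C, [/\ closed_cylinders K, closed_cylinders L, K `<=` A,
    L `<=` ~` A & P (~` (K `|` L)) <= e%:E].

Lemma approximableC P A : approximable P A -> approximable P (~` A).
Proof.
move=> aA e e0; have [K [L [cK cL KA LA H]]] := aA _ e0.
by exists L, K; split; rewrite ?setCK// setUC.
Qed.

Lemma approximable_cylinder P A : cylinder A -> approximable P A.
Proof.
move=> cA e e0; exists A, (~` A); split => //.
- exact: cylinder_closed.
- by apply: cylinder_closed; exact: cylinderC.
- by rewrite setUv setCT measure0 lee_fin ltW.
Qed.

(** An infinite union of the [K n] may leave the class, so it is truncated at some [m], at cost
    [e / 2]; the errors of the pairs [K n], [L n] sum to at most [e / 2]. *)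
Lemma approximable_bigcup P (A : nat -> set C) :
  (forall n, measurable (A n)) ->
  (forall n, approximable P (A n)) -> approximable P (\bigcup_n A n).
Proof.
move=> mA aA e e0.
have /choice[K HK] : forall n, exists K : set C, exists L : set C,
   [/\ closed_cylinders K, closed_cylinders L, K `<=` A n,
    L `<=` ~` A n & P (~` (K `|` L)) <= (e / 2 / (2 ^ n.+1)%:R)%:E].
  by move=> n; apply: aA; rewrite divr_gt0// ?divr_gt0// ltr0n expn_gt0.
have {HK}/choice[L HKL] := HK.
have cK n : closed_cylinders (K n) by case: (HKL n).
have cL n : closed_cylinders (L n) by case: (HKL n).
have KA n : K n `<=` A n by case: (HKL n).
have LA n : L n `<=` ~` A n by case: (HKL n).
have mK n := closed_cylinders_measurable (cK n).
have mL n := closed_cylinders_measurable (cL n).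
pose Km m := \big[setU/set0]_(n < m.+1) K n.
have mKm m : measurable (Km m : set C) by exact: bigsetU_measurable.
have mUK : measurable (\bigcup_n K n : set C) by exact: bigcupT_measurable.
have : P \o Km @ \oo --> P (\bigcup_n K n).
  rewrite -bigcup_bigsetU_bigcup; apply: nondecreasing_cvg_mu => //.
    by rewrite bigcup_bigsetU_bigcup.
  by move=> n m nm; apply/subsetPset; exact: subset_bigsetU.
have e20 : (0 < e / 2)%R by rewrite divr_gt0.
rewrite -(fineK (fin_num_measure P _ mUK)) => /fine_cvgP[_].
move=> /cvgrPdist_le /(_ _ e20)[m _ /(_ m (leqnn m)) /= Hm].
exists (Km m), (\bigcap_n L n); split.
- rewrite /Km; elim: m.+1 => [|k IH]; last by rewrite big_ord_recr; exact: closed_cylindersU.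
  by rewrite big_ord0; apply: cylinder_closed; exact: cylinder0.
- exact: closed_cylinders_bigcap.
- by rewrite /Km -bigcup_mkord => w [n _ Kw]; exists n => //; exact: KA.
- move=> w Lw [n _ Anw]; exact: (LA n w (Lw n Logic.I)).
have sub : ~` (Km m `|` \bigcap_n L n) `<=`
    (\bigcup_n K n `\` Km m) `|` \bigcup_n (~` (K n `|` L n)).
  move=> w; rewrite setCU => -[nK /existsNP[n /not_implyP[_ nL]]].
  have [[k _ Kkw]|nKw] := pselect ((\bigcup_n K n) w).
    by left; split => //; exists k.
  by right; exists n => // -[Kn|//]; apply: nKw; exists n.
have mKL n : measurable (~` (K n `|` L n) : set C).
  by apply: measurableC; exact: measurableU.
have mLL : measurable (\bigcap_n L n : set C) by exact: bigcapT_measurable.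
apply: (@le_trans _ _ (P ((\bigcup_n K n `\` Km m) `|` \bigcup_n (~` (K n `|` L n))))).
  apply: le_measure => //; rewrite inE.
  - by apply: measurableC; exact: measurableU.
  - by apply: measurableU; [exact: measurableD|exact: bigcupT_measurable].
apply: (@le_trans _ _ (P (\bigcup_n K n `\` Km m) + P (\bigcup_n (~` (K n `|` L n))))).
  by apply: measureU2; [exact: measurableD|exact: bigcupT_measurable].
rewrite [leRHS](_ : _ = (e / 2)%:E + (e / 2)%:E); last first.
  by rewrite -EFinD -splitr.
apply: leeD.
  have KmK : Km m `<=` \bigcup_n K n.
    by rewrite /Km -bigcup_mkord; apply: bigcup_subset.
  rewrite measureD//=; last by rewrite ltey_eq fin_num_measure.
  rewrite (setIidr KmK) -(fineK (fin_num_measure P _ mUK)).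
  rewrite -(fineK (fin_num_measure P _ (mKm m))) -EFinB lee_fin.
  by apply: le_trans Hm; exact: ler_norm.
apply: le_trans (epsilon_trick0 predT (ltW e20)).
apply: (@le_trans _ _ (\sum_(n <oo) P (~` (K n `|` L n)))).
  apply: measure_sigma_subadditive => //; exact: bigcupT_measurable.
by apply: lee_nneseries => // n _; case: (HKL n).
Qed.

Lemma measurable_approximable P A : measurable A -> approximable P A.
Proof.
move=> mA; suff : measurable A /\ approximable P A by case.
move: A mA; apply: smallest_sub; last first.
  move=> _ [i _ <-]; split; first by apply: sub_sigma_algebra; exists i.
  apply: approximable_cylinder; exists [:: i] => w w' ww'.
  by rewrite /open_event /mkset ww'// inE.
split.
- by split => //; apply: approximable_cylinder; exact: cylinder0.
- move=> A [mA aA]; rewrite setTD; split; first exact: measurableC.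
  exact: approximableC.
- move=> A HA; split; first by apply: bigcupT_measurable => n; case: (HA n).
  by apply: approximable_bigcup => n; case: (HA n).
Qed.

(** Up to [e], [Q A] is at most [Q K], hence at most the [Q]-probability, and so the
    [P]-probability, of the up-closure of each [G n]. These events decrease to a subset of [A], and
    continuity of [P] from above concludes. *)
Lemma increasing_event_le P Q :
  (forall A, cylinder A -> increasing_event A -> Q A <= P A) ->
  forall A, increasing_event A -> Q A <= P A.
Proof.
move=> H A [mA upA]; apply/lee_addgt0Pr => e e0.
have [K [L [[F cF KF] cL KA LA QKL]]] := measurable_approximable Q mA e0.
pose G n := \bigcap_(i < n.+1) F i.
have cG n : cylinder (G n).
  rewrite /G bigcap_mkord; elim: n => [|n IH].
    by rewrite big_ord_recr big_ord0/= setTI.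
  by rewrite big_ord_recr; exact: cylinderI.
have dG : nonincreasing_seq G.
  move=> n m nm; apply/subsetPset => w Gw i /= iln; apply: Gw.
  exact: leq_trans iln _.
have GK : \bigcap_n G n = K.
  rewrite KF; apply/seteqP; split => w Hw n _; first by apply: (Hw n Logic.I) => /=.
  by move=> i _; exact: Hw.
have upG : \bigcap_n up_closure (G n) `<=` A.
  by apply: up_closure_bigcap => //; rewrite GK.
have mU n : measurable (up_closure (G n) : set C).
  by apply: cylinder_measurable; exact: cylinder_up_closure.
have mK : measurable (K : set C) by apply: closed_cylinders_measurable; exists F.
have mL := closed_cylinders_measurable cL.
have QA : Q A <= Q K + e%:E.
  apply: (@le_trans _ _ (Q (K `|` ~` (K `|` L)))).
    apply: le_measure; rewrite ?inE//.
      by apply: measurableU => //; apply: measurableC; exact: measurableU.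
    move=> w Aw; have [|nK] := pselect (K w); first by left.
    by right => -[//|/LA].
  apply: le_trans (measureU2 _ _ _) _ => //.
    by apply: measurableC; exact: measurableU.
  by rewrite leeD2l.
apply: le_trans QA _; rewrite leeD2r//.
apply: (@le_trans _ _ (P (\bigcap_n up_closure (G n)))); last first.
  by apply: le_measure; rewrite ?inE//; exact: bigcapT_measurable.
have : P \o (fun n => up_closure (G n)) @ \oo --> P (\bigcap_n up_closure (G n)).
  apply: nonincreasing_cvg_mu => //.
  - by rewrite ltey_eq fin_num_measure.
  - exact: bigcapT_measurable.
  - move=> n m nm; apply/subsetPset => w [v Gv vw]; exists v => //.
    by move/subsetPset: (dG _ _ nm); apply.
move=> cvP; rewrite -(cvg_lim _ cvP)//; apply: lime_ge.
  by apply/cvg_ex; exists (P (\bigcap_n up_closure (G n))).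
near=> n => /=; apply: (@le_trans _ _ (Q (up_closure (G n)))).
  apply: le_measure; rewrite ?inE// => w Kw; exists w => //.
  by rewrite -GK in Kw; exact: Kw.
apply: H; first exact: cylinder_up_closure.
split => // w w' [v Gv vw] ww'; exists v => // i.
exact: le_trans (vw i) (ww' i).
Unshelve. all: by end_near. Qed.

Lemma expectation_shift P (f : C -> R) (M : R) :
  measurable_fun setT f -> bounded_fun f ->
  'E_P[fun w => f w + M]%R = 'E_P[f] + M%:E.
Proof.
move=> mf bf; have LF : f \in Lfun P 1.
  rewrite inE; apply/Lfun1_integrable.
  apply: measurable_bounded_integrable => //.
  by rewrite [X in X < _]probability_setT ltry.
rewrite (_ : (fun w => f w + M)%R = (f \+ cst M)%R)//.
by rewrite expectationD ?expectation_cst// Lfun_cst.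
Qed.

(** After a shift making it nonnegative, the function has as expectation the integral of its tail
    probabilities, and its superlevel sets are increasing events. *)
Lemma stoch_dominated_events P Q :
  (forall A, increasing_event A -> Q A <= P A) -> stoch_dominated Q P.
Proof.
move=> H f mf bf fi.
have [M fM] : exists M, forall w, (0 <= f w + M)%R.
  case: bf => M0 [_ /(_ (M0 + 1)%R)]; rewrite ltrDl ltr01 => /(_ isT) fM.
  exists (M0 + 1)%R => w; have := fM w Logic.I; rewrite /= ler_norml.
  by move=> /andP[+ _]; rewrite -subr_ge0 opprK.
rewrite -(leeD2rE _ _ (_ : M%:E \is a fin_num))// -!expectation_shift//.
have mX : (fun w => f w + M)%R \in mfun.
  by rewrite inE; apply: measurable_realfun.measurable_funD => //; exact: measurable_cst.
pose X := mfun_Sub mX.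
have EX S : 'E_S[fun w => f w + M]%R = \int[lebesgue_measure]_(r in `[0%R, +oo[) ccdf (X : {RV S >-> R}) r.
  by rewrite -ge0_expectation_ccdf.
rewrite !EX; apply: ge0_le_integral => //.
- by apply: (measurable_funS measurableT) => //; exact: ccdf_measurable.
- by apply: (measurable_funS measurableT) => //; exact: ccdf_measurable.
- move=> r _; apply: H; split.
    by rewrite -[X in measurable X]setTI; exact: measurable_funP.
  move=> w w' /=; rewrite !in_itv/= !andbT => rX ww'.
  by apply: lt_le_trans rX _; rewrite lerD2r fi.
Qed.

End domination.

(** * Traces on finitely many coordinates *)

Section trace.
Context (R : realType) (I : choiceType) (s : seq I).
Local Notation T := (seq_sub s).
Implicit Types (P Q : percolation R I) (A : pred {set T}) (W : {set T}).

Definition trace (w : I -> bool) : {set T} := [set i : T | w (val i)]%SET.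

Definition trace_event A : set (config I) := [set w | A (trace w)].

Definition trace_law P W : R := fine (P (trace_event (pred1 W))).

Lemma trace_event_sigma (D : set I) (F : {set T}) A :
  (forall x, x \in F -> D (val x)) -> (forall W, A W = A (W :&: F)) ->
  <<s open_events D >> (trace_event A).
Proof.
move=> FD AF; apply: (@determined_sigma _ _ [seq val x | x in F]).
  by move=> i /mapP[x]; rewrite mem_enum => xF ->; exact: FD.
move=> w w' ww'; rewrite /trace_event /mkset AF [in RHS]AF.
congr (is_true (A _)); apply/setP => x; rewrite !inE.
case: (boolP (x \in F)) => xF; last by rewrite !andbF.
by rewrite ww'//; apply: map_f; rewrite mem_enum.
Qed.

Lemma trace_event_measurable A : measurable (trace_event A).
Proof.
by apply: (@trace_event_sigma setT finset.setT) => // W; rewrite finset.setIT.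
Qed.

Lemma trace_eventI A B :
  trace_event (predI A B) = trace_event A `&` trace_event B.
Proof. by apply/seteqP; split => w; [move=> /andP|move=> /andP]. Qed.

Lemma trace_event_law P A : P (trace_event A) = (weight (trace_law P) A)%:E.
Proof.
have -> : trace_event A = \bigcup_(W in [set W | A W]) trace_event (pred1 W).
  apply/seteqP; split => w; first by move=> Aw; exists (trace w) => //; exact: eqxx.
  by move=> [W + /eqP tW]; rewrite /trace_event/= tW.
rewrite measure_fin_bigcup//.
- transitivity (\sum_(W | A W) P (trace_event (pred1 W)))%E.
    rewrite (fsbigE (enum A)) ?enum_uniq//=.
    - rewrite big_enum_cond; apply: eq_bigl => W.
      by apply/andP/idP => [[]//|AW]; split => //; exact/mem_set.
    - by move=> W /=; rewrite mem_enum.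
    - by move=> W AW; rewrite mem_enum => /negP[].
  rewrite /weight -sumEFin; apply: eq_bigr => W _.
  by rewrite /trace_law fineK// fin_num_measure//; exact: trace_event_measurable.
- exact: finite_finset.
- move=> W W' _ _ [w [/eqP <- /eqP <-]] //.
- by move=> W _; exact: trace_event_measurable.
Qed.

Lemma trace_law_ge0 P W : 0 <= trace_law P W.
Proof. exact: fine_ge0. Qed.

Lemma trace_law_sum P : \sum_W trace_law P W = 1.
Proof.
apply: EFin_inj; rewrite -(trace_event_law P predT).
by rewrite -[RHS](@probability_setT _ _ _ P); congr (P _); apply/seteqP; split.
Qed.

Lemma trace_event_increasing A : up_closed A -> increasing_event (trace_event A).
Proof.
move=> uA; split; first exact: trace_event_measurable.
move=> w w' Aw ww'; apply: uA Aw; apply/fintype.subsetP => x; rewrite !inE => wx.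
by have := ww' (val x); rewrite wx; case: (w' _).
Qed.

(** The bound on near elements is stated for duplicate-free lists because [I] may be infinite. *)
Lemma trace_local_law P (near : rel I) (N : nat) (p : R) :
  symmetric near -> reflexive near ->
  (forall x t, uniq t -> {in t, forall y, near x y} -> (size t <= N)%N) ->
  0 <= p <= 1 -> positively_associated P -> has_marginals P p ->
  (forall D1 D2 : set I, (forall x y, D1 x -> D2 y -> ~~ near x y) ->
    forall A1 A2 : set (config I),
    <<s open_events D1 >> A1 -> <<s open_events D2 >> A2 ->
    P (A1 `&` A2) = (P A1 * P A2)%E) ->
  local_law (fun x y : T => near (val x) (val y)) N (trace_law P) p.
Proof.
move=> near_sym near_refl near_card p01 assoc marg indep; split => //.
- move=> x; rewrite cardE -(size_map val); apply: (near_card (val x)).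
    by rewrite map_inj_uniq ?enum_uniq//; exact: val_inj.
  by move=> _ /mapP[y + ->]; rewrite mem_enum inE.
- exact: trace_law_ge0.
- exact: trace_law_sum.
- move=> A B uA uB; rewrite -lee_fin EFinM -!trace_event_law trace_eventI.
  exact: assoc (trace_event_increasing uA) (trace_event_increasing uB).
- move=> F1 F2 far A1 A2 h1 h2; apply: EFin_inj; rewrite EFinM -!trace_event_law trace_eventI.
  apply: (indep (val @` [set` F1]) (val @` [set` F2])).
  + by move=> _ _ [x xF1 <-] [y yF2 <-]; exact: far.
  + by apply: trace_event_sigma h1 => x xF; exists x.
  + by apply: trace_event_sigma h2 => x xF; exists x.
- move=> e; apply: EFin_inj; rewrite -trace_event_law -(marg (val e)).
  by congr (P _); apply/seteqP; split => w; rewrite /trace_event /= inE.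
Qed.

Lemma trace_law_bern Q (q : R) A : bernoulli_law q Q ->
  weight (trace_law Q) A = weight (bern q) A.
Proof.
move=> [marg indep]; apply: eq_bigr => W _.
pose b i := if insub i is Some x then x \in W else false.
have bE (x : T) : b (val x) = (x \in W) by rewrite /b valK.
have one i c : Q [set w | w i = c] = (if c then q else 1 - q)%:E.
  have -> : [set w | w i = c] = if c then open_event i else ~` open_event i.
    case: c; apply/seteqP; split => w //=; rewrite /open_event /=.
      by move=> ->.
    by case: (w i).
  case: c; first exact: marg.
  rewrite probability_setC; first by rewrite marg.
  by apply: sub_sigma_algebra; exists i.
apply: EFin_inj; rewrite /trace_law fineK; last first.
  by rewrite fin_num_measure//; exact: trace_event_measurable.
have U : uniq [seq val x | x <- index_enum T].
  rewrite map_inj_uniq; last exact: val_inj.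
  by rewrite /index_enum -enumT enum_uniq.
transitivity (Q [set w | forall i, i \in [seq val x | x <- index_enum T] -> w i = b i]).
  congr (Q _); apply/seteqP; split => w.
    move=> /eqP tW i /mapP[x _ ->].
    by rewrite bE -tW inE.
  move=> H; apply/eqP/setP => x; rewrite inE -bE; apply: H.
  by apply: map_f; rewrite mem_index_enum.
rewrite indep// big_map /bern -prodEFin; apply: eq_bigr => x _.
by rewrite bE one.
Qed.

Lemma cylinder_trace (A : set (config I)) : determined s A ->
  A = trace_event (fun W => `[< A (fun i => if insub i is Some x then x \in W else false) >]).
Proof.
move=> dA; apply/seteqP; split => w.
  move=> Aw; apply/asboolP; rewrite -(dA w)// => i si.
  by rewrite insubT inE.
move=> /asboolP; rewrite -(dA w)// => i si.
by rewrite insubT inE.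
Qed.

End trace.

(** * Edges at distance less than k *)

Lemma card_le_seq (T : choiceType) (A : set T) (n : nat) : (A #<= `I_n)%card ->
  exists2 r : seq T, (size r <= n)%N & forall x, A x -> x \in r.
Proof.
move=> An; have fA : finite_set A := card_le_finite An (finite_II n).
exists (fset_set A) => [|x Ax]; first exact: geq_card_fset_set.
by rewrite in_fset_set//; exact/mem_set.
Qed.

Section near_edges.
Context (R : realType) (G : graph) (Delta k : nat).
Implicit Types (u v : G) (e f : edge G).

Lemma dist_sym u v : dist R u v = dist R v u.
Proof.
suff H x y : [set ((size s)%:R%:E : \bar R) | s in
      [set s : seq G | path (@adj G) x s /\ last x s = y]] `<=`
    [set ((size s)%:R%:E : \bar R) | s in
      [set s : seq G | path (@adj G) y s /\ last y s = x]].
  by congr ereal_inf; apply/seteqP; split; exact: H.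
move=> _ [s [ps lx] <-]; exists (rev (belast x s)); last by rewrite size_rev size_belast.
split; last by case: (s) lx => [/= ->//|a t _]; rewrite /= rev_cons last_rcons.
rewrite -lx rev_path; apply: sub_path ps => a b; by rewrite adj_sym.
Qed.

Lemma edge_dist_sym e f : edge_dist R e f = edge_dist R f e.
Proof.
suff H e' f' : [set dist R uv.1 uv.2 | uv in val e' `*` val f'] `<=`
    [set dist R uv.1 uv.2 | uv in val f' `*` val e'].
  by congr ereal_inf; apply/seteqP; split; exact: H.
by move=> _ [[u v] [/= eu fv] <-]; exists (v, u) => //=; exact: dist_sym.
Qed.

Definition near_edges : rel (edge G) :=
  fun e f => (edge_dist R e f < k%:R%:E)%E.

Lemma near_edges_sym : symmetric near_edges.
Proof. by move=> e f; rewrite /near_edges edge_dist_sym. Qed.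

Lemma near_edges_refl : (0 < k)%N -> reflexive near_edges.
Proof.
move=> k0 e; have [u [v [uv E]]] : edges G (val e) by exact: set_valP.
apply: (@le_lt_trans _ _ 0%E); last by rewrite lte_fin ltr0n.
apply: (@le_trans _ _ (dist R u u)).
  by apply: ereal_inf_lbound; exists (u, u) => //; split; rewrite E; left.
by apply: ereal_inf_lbound; exists [::].
Qed.

Lemma near_edgesP e f : near_edges e f -> exists u v s,
  [/\ val e u, val f v, path (@adj G) u s, last u s = v & (size s < k)%N].
Proof.
move=> /ereal_inf_lt[_ [[u v] [/= eu fv] <-]] /ereal_inf_lt[_ [s [ps ls] <-]].
by rewrite lte_fin ltr_nat => sk; exists u, v, s; split.
Qed.

Hypothesis degG : forall v, (neighbours v #<= `I_Delta)%card.

Let neighbour_seq : exists nbs : G -> seq G, forall v,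
  (size (nbs v) <= Delta)%N /\ forall u, adj v u -> u \in nbs v.
Proof.
have /choice[nbs H] : forall v : G, exists r : seq G,
    (size r <= Delta)%N /\ forall u, adj v u -> u \in r.
  move=> v; have [r rD H] := card_le_seq (degG v).
  by exists r; split => // u vu; exact: H.
by exists nbs.
Qed.

(** An edge near [e] has an endpoint within [k] steps of one of the two endpoints of [e]. At most
    [Delta.+1 ^ k] vertices are listed around each of these, and each vertex has at most [Delta]
    edges. *)
Lemma near_edges_card e (t : seq (edge G)) : uniq t ->
  {in t, forall f, near_edges e f} ->
  (size t <= (Delta.+1 ^ k * Delta).*2)%N.
Proof.
move=> ut nt; have [nbs H] := neighbour_seq.
have nbs_size v : (size (nbs v) <= Delta)%N by case: (H v).
have nbsP v u : adj v u -> u \in nbs v by case: (H v) => _; exact.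
(* [reach n v] contains, with repetitions, the ends of all walks of at most [n] steps from [v]. *)
pose reach := fix reach n v := if n is n'.+1 then
  v :: flatten [seq reach n' w | w <- nbs v] else [:: v].
have size_flat (S S' : eqType) (h : S -> seq S') (r : seq S) b :
    (forall w, size (h w) <= b)%N -> (size (flatten [seq h w | w <- r]) <= size r * b)%N.
  move=> hb; elim: r => //= w r IH; rewrite size_cat mulSn leq_add//.
have size_reach n v : (size (reach n v) <= Delta.+1 ^ n)%N.
  elim: n v => //= n IH v; rewrite expnS mulSn -add1n leq_add ?expn_gt0//.
  apply: leq_trans (size_flat _ _ _ _ _ (IH)) _.
  by rewrite leq_mul2r nbs_size orbT.
have reachP n v s : path (@adj G) v s -> (size s <= n)%N -> last v s \in reach n v.
  elim: n v s => [|n IH] v [|w s] //=; rewrite ?inE ?eqxx//.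
  move=> /andP[vw ps] sn; apply/orP; right; apply/flattenP.
  by exists (reach n w); [apply: map_f; exact: nbsP|exact: IH].
have [a [b [ab E]]] : edges G (val e) by exact: set_valP.
pose code v : seq (set G) := [seq [set v; w] | w <- nbs v].
pose codes := flatten [seq code v | v <- reach k a ++ reach k b].
have sub : {subset [seq val f | f <- t] <= codes}.
  move=> _ /mapP[f /nt /near_edgesP[u [v [s [eu fv ps ls sk]]]] ->].
  apply/flattenP; exists (code v).
    apply: map_f; rewrite mem_cat -ls.
    move: eu ps sk; rewrite E => -[|] -> ps /ltnW sk; rewrite reachP ?orbT//.
  have [x [y [xy Ef]]] : edges G (val f) by exact: set_valP.
  move: fv; rewrite Ef => -[|] ->; first by apply/mapP; exists y => //; exact: nbsP.
  by rewrite setUC; apply/mapP; exists x => //; apply: nbsP; rewrite adj_sym.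
rewrite -(size_map val); apply: leq_trans (uniq_leq_size _ sub) _.
  by rewrite map_inj_uniq//; exact: val_inj.
apply: leq_trans (size_flat _ _ _ _ Delta _) _.
  by move=> v; rewrite /code size_map.
by rewrite size_cat -addnn -mulnDl leq_mul2r leq_add ?orbT.
Qed.

(** Reflexivity, where [0 < k] enters, makes sets without near pairs disjoint; the absence of near
    pairs puts them at distance at least [k]. *)
Lemma k_independent_near (P : percolation R (edge G)) : (0 < k)%N ->
  k_independent k P ->
  forall D1 D2 : set (edge G), (forall x y, D1 x -> D2 y -> ~~ near_edges x y) ->
  forall A1 A2 : set (config (edge G)),
    <<s open_events D1 >> A1 -> <<s open_events D2 >> A2 ->
    P (A1 `&` A2) = (P A1 * P A2)%E.
Proof.
move=> k0 kP D1 D2 far; apply: kP.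
  apply/seteqP; split => // e [D1e D2e].
  by have := far _ _ D1e D2e; rewrite near_edges_refl.
apply: le_ereal_inf_tmp => _ [[e f] [/= D1e D2f] <-].
by have := far _ _ D1e D2f; rewrite /near_edges -leNgt.
Qed.

End near_edges.

(** * Rate functions *)

Section homeomorphisms.
Context (R : realType).
Implicit Types (f g : R -> R) (x p : R).

Lemma in01 x : (x \in `[0, 1]) = (0 <= x <= 1).
Proof. by rewrite in_itv. Qed.

(** A monotone bijection of the segment is continuous because its range has no gaps; this applies to
    [f] and [g] alike. *)
Lemma increasing_homeomorphism_can f g :
  {homo f : x / x \in `[0, 1]} -> {homo g : x / x \in `[0, 1]} ->
  {in `[0, 1] &, {homo f : x y / x < y}} ->
  {in `[0, 1], cancel f g} -> {in `[0, 1], cancel g f} ->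
  increasing_homeomorphism f.
Proof.
move=> f01 g01 fi fK gK.
have cont (h h' : R -> R) : {homo h : x / x \in `[0, 1]} -> {homo h' : x / x \in `[0, 1]} ->
    {in `[0, 1] &, {mono h : x y / x <= y}} -> {in `[0, 1], cancel h' h} ->
    {within `[0, 1], continuous h}.
  move=> h01 h'01 hm hK; apply: segment_inc_surj_continuous => // y /=.
  rewrite in_itv /= => /andP[y0 y1].
  have y01 : y \in `[0, 1].
    have /andP[h0 _] : 0 <= h 0 <= 1 by rewrite -in01 h01// in01 lexx ler01.
    have /andP[_ h1] : 0 <= h 1 <= 1 by rewrite -in01 h01// in01 lexx ler01.
    by rewrite in01 (le_trans h0)// (le_trans y1).
  by exists (h' y); [exact: h'01|exact: hK].
have fm : {in `[0, 1] &, {mono f : x y / x <= y}} by exact: le_mono_in.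
have gm : {in `[0, 1] &, {mono g : x y / x <= y}}.
  by move=> x y x01 y01; rewrite -fm ?g01// !gK.
by split => //; exists g; split => //; split; [exact: (cont f g)|exact: (cont g f)].
Qed.

Lemma onem01 x : x \in `[0, 1] -> 1 - x \in `[0, 1].
Proof. by rewrite !in01 subr_ge0 gerBl => /andP[-> ->]. Qed.

(** Conjugation by the reflection of [p] to [1 - p] yields [sigma] from [rho]. *)
Lemma increasing_homeomorphism_onem f :
  increasing_homeomorphism f -> increasing_homeomorphism (fun p => 1 - f (1 - p)).
Proof.
move=> [fi [g [f01 g01 fK gK _]]].
apply: (@increasing_homeomorphism_can _ (fun p => 1 - g (1 - p))).
- by move=> x x01; apply/onem01/f01/onem01.
- by move=> x x01; apply/onem01/g01/onem01.
- move=> x y x01 y01 xy; rewrite ltrD2l ltrN2; apply: fi; rewrite ?onem01//.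
  by rewrite ltrD2l ltrN2.
- by move=> x x01; rewrite subKr fK ?subKr// onem01.
- by move=> x x01; rewrite subKr gK ?subKr// onem01.
Qed.

Definition root (n : nat) x : R := x `^ n%:R^-1.

Lemma root_ge0 n x : 0 <= root n x.
Proof. exact: powR_ge0. Qed.

Lemma rootK n x : (0 < n)%N -> 0 <= x -> root n x ^+ n = x.
Proof.
move=> n0 x0; rewrite /root -powR_mulrn ?powR_ge0// -powRrM mulVf ?powRr1//.
by rewrite pnatr_eq0 -lt0n.
Qed.

Lemma exprK_root n x : (0 < n)%N -> 0 <= x -> root n (x ^+ n) = x.
Proof.
move=> n0 x0; rewrite /root -powR_mulrn// -powRrM mulfV ?powRr1//.
by rewrite pnatr_eq0 -lt0n.
Qed.

Lemma ltr_root n x y : (0 < n)%N -> 0 <= x -> 0 <= y -> (root n x < root n y) = (x < y).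
Proof.
move=> n0 x0 y0; rewrite -[in RHS](rootK n0 x0) -[in RHS](rootK n0 y0).
by rewrite ltr_pXn2r// nnegrE root_ge0.
Qed.

Lemma root01 n x : (0 < n)%N -> x \in `[0, 1] -> root n x \in `[0, 1].
Proof.
move=> n0; rewrite !in01 root_ge0 /= => /andP[x0 x1].
by rewrite -(@expr_le1 _ n)// ?rootK// root_ge0.
Qed.

Lemma expr01 n x : x \in `[0, 1] -> x ^+ n \in `[0, 1].
Proof. by rewrite !in01 => /andP[x0 x1]; rewrite exprn_ge0// exprn_ile1. Qed.

(** The rate of [bern_root_bound], with [d] the [L]-th root of [1 - p]. *)
Definition root_rate (L M : nat) p : R := (1 - root L (1 - p)) ^+ M.

Lemma root_rate01 L M : (0 < L)%N -> {homo root_rate L M : x / x \in `[0, 1]}.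
Proof. by move=> L0 x x01; apply/expr01/onem01/root01/onem01. Qed.

Lemma root_rate_homeomorphism L M : (0 < L)%N -> (0 < M)%N ->
  increasing_homeomorphism (root_rate L M).
Proof.
move=> L0 M0.
apply: (@increasing_homeomorphism_can _ (fun q => 1 - (1 - root M q) ^+ L)).
- exact: root_rate01.
- by move=> x x01; apply/onem01/expr01/onem01/root01.
- move=> x y x01 y01 xy.
  have := onem01 (root01 L0 (onem01 x01)); have := onem01 (root01 L0 (onem01 y01)).
  rewrite !in01 => /andP[y0 _] /andP[x0 _].
  rewrite ltr_pXn2r ?nnegrE// ltrD2l ltrN2 ltr_root//.
  + by rewrite ltrD2l ltrN2.
  + by move: (onem01 y01); rewrite in01 => /andP[].
  + by move: (onem01 x01); rewrite in01 => /andP[].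
- move=> x x01; rewrite exprK_root// ?subKr ?rootK ?subKr//.
  + by move: (onem01 x01); rewrite in01 => /andP[].
  + by move: (onem01 (root01 L0 (onem01 x01))); rewrite in01 => /andP[].
- move=> x x01; rewrite /root_rate subKr exprK_root// ?subKr ?rootK//.
  + by move: x01; rewrite in01 => /andP[].
  + by move: (onem01 (root01 M0 x01)); rewrite in01 => /andP[].
Qed.

End homeomorphisms.

(* Choice of the rates and the two dominations *)
Local Close Scope classical_set_scope.

Theorem theorem2 (R : realType) (Delta k : nat) (hk : (1 <= k)%N) :
  exists rho sigma : R -> R,
    increasing_homeomorphism rho /\ increasing_homeomorphism sigma /\
    forall (G : graph) (p : R) (P : percolation R (edge G)),
      has_max_degree G Delta ->
      0 <= p <= 1 ->
      positively_associated P -> k_independent k P -> has_marginals P p ->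
      stoch_dominated (bernoulli_percolation (edge G) (rho p)) P /\
      stoch_dominated P (bernoulli_percolation (edge G) (sigma p)).
Proof.
(* [N] is the bound of [near_edges_card]; [L] and [M] are the exponents occurring in
   [bern_root_bound]. *)
pose N := (Delta.+1 ^ k * Delta).*2; pose L := (N + N).+1.
pose M := (N * (L * N).+1).+2.
exists (root_rate L M), (fun p => 1 - root_rate L M (1 - p)).
have hom : increasing_homeomorphism (root_rate L M : R -> R).
  exact: root_rate_homeomorphism.
split => //; split; first exact: increasing_homeomorphism_onem.
move=> G p P [degG _] p01 assoc indep marg.
have /andP[p0 p1] := p01.
have q01 : 0 <= root_rate L M p <= 1.
  by rewrite -in01 root_rate01// in01.
have r01 : 0 <= 1 - root_rate L M (1 - p) <= 1.
  by rewrite -in01 onem01// root_rate01// onem01// in01.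
have law s : local_law (fun x y : seq_sub s => near_edges R k (val x) (val y))
    N (trace_law P) p.
  apply: trace_local_law => //.
  - exact: near_edges_sym.
  - exact: near_edges_refl.
  - move=> e t; exact: near_edges_card.
  - exact: k_independent_near.
have upA s (A : set (config (edge G))) : increasing_event A ->
    up_closed (fun W : {set seq_sub s} => `[< A (fun i =>
      if insub i is Some x then x \in W else false) >]).
  move=> [_ uA] W W' /fintype.subsetP WW' /asboolP AW; apply/asboolP.
  apply: uA AW _ => i; case: insub => // x.
  by case: (boolP (x \in W)) => // /WW' ->.
split; apply: stoch_dominated_events; apply: increasing_event_le => A [s sA] iA;
  rewrite (cylinder_trace sA) !trace_event_law lee_fin.
- rewrite (trace_law_bern _ (bernoulli_percolationP _ q01)).
  apply: (bern_root_bound (law s)) (upA _ _ iA) (root_ge0 _ _) _.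
  by rewrite rootK// subr_ge0.
- rewrite (trace_law_bern _ (bernoulli_percolationP _ r01)).
  rewrite /root_rate subKr.
  apply: (bern_root_bound_dual (law s)) (upA _ _ iA) (root_ge0 _ _) _.
  by rewrite rootK.
Qed.
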